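(* Let $k\in\mathbb{N}_0$ and $r\in[0,\infty)$ be fixed and such that $\max\{k,r\}>0$. Then $$\lim_{n\to\infty}\frac{\mathbb{E}\bigl[e^{z\,\mathrm{Lah}(n,k)_r}\bigr]}{e^{(k+r)(\log n)(e^z-1)}}=\frac{\Gamma(k+2r)}{\Gamma((k+r)e^z+r)}$$ for every $z\in\mathcal{D}_{\mathrm{Lah}}:=\{t\in\mathbb{C}:\cos(\operatorname{Im}t)>0\}\supseteq\mathbb{R}$. This convergence is uniform as long as $z$ stays in any compact subset $K$ of $\mathcal{D}_{\mathrm{Lah}}$, and the speed of convergence (uniformly on $K$) is $O(n^{-\varepsilon(K)})$ for some $\varepsilon(K)>0$.
   Context: $\mathbb{N}=\{1,2,\ldots\}$, $\mathbb{N}_0=\mathbb{N}\cup\{0\}$. Let $\genfrac{[}{]}{0pt}{}{n}{k}$ and $\genfrac{\{}{\}}{0pt}{}{n}{k}$ be the (unsigned) Stirling numbers of the first kind (number of permutations of $\{1,\dots,n\}$ with exactly $k$ cycles) and of the second kind (number of partitions of $\{1,\dots,n\}$ into $k$ non-empty subsets). For $n\in\mathbb{N}_0$, $k\in\{0,\ldots,n\}$ and $r\in\mathbb{R}$ the $r$-Stirling numbers are defined (with $0^0=1$) by $$\genfrac{[}{]}{0pt}{}{n}{k}_r=\sum_{j=k}^n\genfrac{[}{]}{0pt}{}{n}{j}\binom{j}{k}r^{j-k},\qquad \genfrac{\{}{\}}{0pt}{}{n}{k}_r=\sum_{j=k}^n\binom{n}{j}\genfrac{\{}{\}}{0pt}{}{j}{k}r^{n-j}.$$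 The $r$-Lah number is $L(n,k)_r=\sum_{j=k}^n\genfrac{[}{]}{0pt}{}{n}{j}_r\genfrac{\{}{\}}{0pt}{}{j}{k}_r$. For $n\in\mathbb{N}$, $k\in\{0,\ldots,n\}$, $r\in[0,\infty)$ with $\max\{k,r\}>0$, $\mathrm{Lah}(n,k)_r$ denotes a random variable with the $r$-Lah distribution $$\mathbb{P}[\mathrm{Lah}(n,k)_r=j]=\frac{1}{L(n,k)_r}\genfrac{[}{]}{0pt}{}{n}{j}_r\genfrac{\{}{\}}{0pt}{}{j}{k}_r,\qquad j\in\{k,k+1,\ldots,n\}.$$ $\Gamma$ is Euler's Gamma function. *)

(* Defs.v *)
From HB Require Import structures.
From mathcomp Require Import all_boot all_order all_algebra all_fingroup.
From mathcomp Require Import complex.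
From mathcomp Require Import all_classical all_reals all_analysis.

Set Implicit Arguments.
Unset Strict Implicit.
Unset Printing Implicit Defensive.

Import Order.TTheory GRing.Theory Num.Theory.
Import numFieldNormedType.Exports.

Local Open Scope classical_set_scope.
Local Open Scope ring_scope.
Local Open Scope complex_scope.

Definition stirling1 (n k : nat) : nat :=
  #|[set s : 'S_n | #|porbits s| == k]%SET|.

Definition stirling2 (n k : nat) : nat :=
  #|[set Q : {set {set 'I_n}} |
      finset.partition Q [set: 'I_n]%SET && (#|Q| == k)]%SET|.

Definition rstirling1 (R : realType) (n k : nat) (r : R) : R :=
  \sum_(k <= j < n.+1) (stirling1 n j)%:R * 'C(j, k)%:R * r ^+ (j - k).

Definition rstirling2 (R : realType) (n k : nat) (r : R) : R :=
  \sum_(k <= j < n.+1) 'C(n, j)%:R * (stirling2 j k)%:R * r ^+ (n - j).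

Definition rlah (R : realType) (n k : nat) (r : R) : R :=
  \sum_(k <= j < n.+1) rstirling1 n j r * rstirling2 j k r.

(* The point masses below add up to 1, so they determine the law of X even
   though X is a priori an arbitrary real random variable. *)
Definition has_rlah_distribution (R : realType) (d : measure_display)
    (T : measurableType d) (P : probability T R) (n k : nat) (r : R)
    (X : {RV P >-> R}) : Prop :=
  forall j : nat, (k <= j <= n)%N ->
    P (X @^-1` [set j%:R]) =
      ((rlah n k r)^-1 * (rstirling1 n j r * rstirling2 j k r))%:E.

Definition expC (R : realType) (z : R[i]) : R[i] :=
  (expR (complex.Re z))%:C *
    (cos (complex.Im z) +i* sin (complex.Im z)).

Definition integralC (R : realType) (d : measure_display)
    (T : measurableType d) (mu : {measure set T -> \bar R}) (D : set T)
    (f : T -> R[i]) : R[i] :=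
  (\int[mu]_(t in D) complex.Re (f t)) +i* (\int[mu]_(t in D) complex.Im (f t)).

Definition expectationC (R : realType) (d : measure_display)
    (T : measurableType d) (P : probability T R) (Y : T -> R[i]) : R[i] :=
  fine 'E_P[fun w => complex.Re (Y w)] +i* fine 'E_P[fun w => complex.Im (Y w)].

(* Euler's integral of t^(s-1) e^(-t) over ]0, +oo[, with
   t^(s-1) = e^((s-1) log t); it represents Gamma on Re s > 0 only, and is a
   meaningless value elsewhere. *)
Definition gammaC (R : realType) (s : R[i]) : R[i] :=
  integralC (@lebesgue_measure R) `]0, +oo[
    (fun t : R => expC ((s - 1) * (ln t)%:C - t%:C)).

Definition D_Lah (R : realType) : set R[i] :=
  [set t | 0 < cos (complex.Im t)].

Definition lah_mgf_ratio (R : realType) (d : measure_display)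
    (T : measurableType d) (P : probability T R) (X : {RV P >-> R})
    (n k : nat) (r : R) (z : R[i]) : R[i] :=
  expectationC P (fun w => expC (z * (X w)%:C)) /
    expC ((k%:R + r)%:C * (ln n%:R)%:C * (expC z - 1)).

Definition lah_mgf_limit (R : realType) (k : nat) (r : R) (z : R[i]) : R[i] :=
  gammaC (k%:R + 2 * r)%:C / gammaC ((k%:R + r)%:C * expC z + r%:C).

(* Main.v *)
(** Write u = e^z, let x^(n) = x (x + 1) ... (x + n - 1) be the rising factorial
    and put s_i(u) = (i + r) u + r. The generating polynomial of the Stirling
    numbers of the first kind and the explicit alternating sum for those of the
    second kind give
      k! L(n,k)_r E[u^Lah(n,k)_r] = \sum_i (-1)^(k-i) C(k,i) s_i(u)^(n),
    the sum being over 0 <= i <= k. The case u = 1 computes L(n,k)_r, so only the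
    growth of s^(n) matters. Since Gamma(s) s^(n) = Gamma(s + n), the quotient
    Gamma(s) s^(n) / ((n-1)! n^s) is the expectation of (G/n)^s for a
    Gamma(n)-distributed G; it is 1 + O(n^(-1/2)) locally uniformly on Re s > 0
    because |x^s - 1| <= c |x - 1| (1 + x^M) and G/n has variance 1/n. Hence
    s^(n) / ((n-1)! n^s) tends to 1 / Gamma(s) at that rate. The term i = k of the
    sum dominates and the others are smaller by the factors n^(-(k-i) Re u), which
    is where the condition Re e^z > 0, i.e. cos(Im z) > 0, enters. *)

Require Import Defs.
From HB Require Import structures.
From mathcomp Require Import all_boot all_order all_algebra all_fingroup.
From mathcomp Require Import complex.
From mathcomp Require Import all_classical all_reals all_analysis.
From mathcomp Require Import measurable_realfun ring lra.

Set Implicit Arguments.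
Unset Strict Implicit.
Unset Printing Implicit Defensive.

Import Order.TTheory GRing.Theory Num.Theory.
Import numFieldNormedType.Exports.

Local Open Scope classical_set_scope.
Local Open Scope ring_scope.
Local Open Scope complex_scope.

(** * Stirling numbers *)

(** The delicate point is uniformity: the constants for Gamma depend only on an integer [M] bounding
    |s|, not on a lower bound for Re s. The basic estimate concerns the product of Gamma(s) with the
    normalised rising factorial; dividing by Gamma(s) requires |Gamma| to stay away from 0 on
    bounded parts of the half plane. The estimate itself yields this: at one index n0 the product is
    within 1/2 of 1, while a rising factorial of fixed length n0 is bounded, so |Gamma(s)| cannot be
    small. One term may leave the half plane: for r = 0 and i = 0 the point s_0(u) is 0, where
    Euler's integral says nothing but the rising factorial vanishes. Numerator and normalisation are
    the same alternating sum at u = e^z and u = 1, so L(n,k)_r is nonzero for large n because the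
    limit 1 / Gamma(k + 2r) is. The exponent obtained on K is the minimum of 1/2, from the variance
    of G/n, and of a lower bound of Re e^z on K, from the terms i < k. *)

Lemma lift_permX n (i : 'I_n.+1) (s : 'S_n) m :
  (lift_perm i i s ^+ m)%g = lift_perm i i (s ^+ m)%g.
Proof.
elim: m => [|m IHm]; first by rewrite !expg0 lift_perm1.
by rewrite !expgS IHm lift_permM.
Qed.

Lemma porbit_lift_perm n (i : 'I_n.+1) (s : 'S_n) x :
  porbit (lift_perm i i s) (lift i x) = (lift i @: porbit s x)%SET.
Proof.
apply/setP => y; apply/porbitP/imsetP => [[m ->]|[z /porbitP[m ->] ->]].
  by exists ((s ^+ m)%g x); rewrite ?mem_porbit// lift_permX lift_perm_lift.
by exists m; rewrite lift_permX lift_perm_lift.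
Qed.

Lemma porbit_lift_perm_id n (i : 'I_n.+1) (s : 'S_n) :
  porbit (lift_perm i i s) i = [set i]%SET.
Proof.
apply/setP => y; rewrite inE; apply/porbitP/eqP => [[m ->]|->].
  by rewrite lift_permX lift_perm_id.
by exists 0%N; rewrite expg0 perm1.
Qed.

(** The orbits of [s] are transported by [lift i], which misses the fixed point [i]; so [[set i]] is
    one additional orbit. *)
Lemma card_porbits_lift_perm n (i : 'I_n.+1) (s : 'S_n) :
  #|porbits (lift_perm i i s)| = #|porbits s|.+1.
Proof.
have -> : porbits (lift_perm i i s) =
    ([set i] |: [set lift i @: (A : {set _}) | A in porbits s])%SET.
  apply/setP => A; rewrite in_setU1; apply/imsetP/orP.
    case=> x _ ->; case: (unliftP i x) => [y|] ->.
      right; apply/imsetP; exists (porbit s y); first by apply/imsetP; exists y.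
      exact: porbit_lift_perm.
    by left; rewrite porbit_lift_perm_id.
  case=> [/eqP ->|/imsetP[_ /imsetP[x _ ->] ->]].
    by exists i; rewrite ?porbit_lift_perm_id.
  by exists (lift i x); rewrite ?porbit_lift_perm.
rewrite cardsU1 card_imset; last exact: imset_inj (@lift_inj _ i).
suff -> : ([set i] \in [set lift i @: (A : {set _}) | A in porbits s])%SET = false.
  by rewrite add1n.
apply/negbTE/imsetP => -[A _ eqA]; have := set11 i; rewrite eqA.
by move=> /imsetP[y _ /eqP]; rewrite (negbTE (neq_lift i y)).
Qed.

(** Since (n + 1) n! = (n + 1)!, injectivity suffices. The index [p.1] is recovered as the preimage
    of [ord_max], and then [p.2] by cancelling the transposition. *)
Lemma perm_tperm_lift_bij n :
  bijective (fun p : 'I_n.+1 * 'S_n =>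
    (tperm ord_max p.1 * lift_perm ord_max ord_max p.2)%g).
Proof.
apply: inj_card_bij; last first.
  by rewrite card_prod !card_Sn card_ord factS.
move=> [j s] [j' s'] /= eqf.
have E : j = j'.
  have := congr1 (fun f : 'S_n.+1 => f j') eqf.
  rewrite !permM tpermR lift_perm_id => /esym.
  rewrite -[X in X = _](lift_perm_id ord_max ord_max s) => /perm_inj.
  by case: tpermP => [-> <-//|->//|+ _ jm]; rewrite jm.
subst j'; congr pair.
move/mulgI: eqf => /permP eqf; apply/permP => x.
by have := eqf (lift ord_max x); rewrite !lift_perm_lift => /lift_inj.
Qed.

Definition rising (A : pzRingType) (x : A) (n : nat) : A :=
  \prod_(i < n) (x + i%:R).

(** Induction by the preceding bijection: the choice j = [ord_max] leaves [ord_max] as an extra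
    cycle and contributes x, while each of the n other choices merges it into the cycle of [j] and
    contributes 1. Together they give the factor x + n. *)
Lemma rising_sum_porbits (A : comNzRingType) (x : A) n :
  \sum_(s : 'S_n) x ^+ #|porbits s| = rising x n.
Proof.
rewrite /rising; elim: n => [|n IHn].
  rewrite big_ord0 (eq_bigr (fun=> 1)) => [|s _].
    by rewrite sumr_const card_Sn.
  have -> : #|porbits s| = 0%N; last by rewrite expr0.
  by apply/eqP; rewrite cards_eq0; apply/eqP/setP => A0; rewrite inE;
    apply/negbTE/imsetP => -[[]].
rewrite big_ord_recr /= -IHn.
rewrite (reindex _ (onW_bij _ (@perm_tperm_lift_bij n))) /=.
rewrite -(pair_bigA _ (fun j s => x ^+ #|porbits
  (tperm ord_max j * lift_perm ord_max ord_max s)%g|)) exchange_big /=.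
rewrite big_distrl /=; apply: eq_bigr => s _.
rewrite big_ord_recr /= tperm1 mul1g card_porbits_lift_perm exprS.
rewrite (eq_bigr (fun=> x ^+ #|porbits s|)) => [|j _].
  rewrite sumr_const card_ord -mulr_natr; move: (x ^+ _) => y; ring.
have := porbits_mul_tperm (lift_perm ord_max ord_max s) ord_max
  (widen_ord (leqnSn n) j).
have jn : ord_max != widen_ord (leqnSn n) j.
  by rewrite -val_eqE /= eq_sym ltn_eqF.
have -> : ord_max \notin porbit (lift_perm ord_max ord_max s)
    (widen_ord (leqnSn n) j).
  by rewrite porbit_sym porbit_lift_perm_id inE eq_sym.
by rewrite jn card_porbits_lift_perm /= !addn2 addn1 => -[] ->.
Qed.

Lemma sum_stirling1 (A : comNzRingType) (x : A) n :
  \sum_(j < n.+1) (stirling1 n j)%:R * x ^+ j = rising x n.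
Proof.
rewrite -rising_sum_porbits.
pose h (s : 'S_n) : 'I_n.+1 := inord #|porbits s|.
have hE s : h s = #|porbits s| :> nat.
  rewrite inordK// ltnS -[X in (_ <= X)%N]card_ord /porbits.
  exact: leq_imset_card.
rewrite (partition_big h xpredT) //=; apply: eq_bigr => j _.
rewrite (eq_bigr (fun=> x ^+ j)); last by move=> s /eqP <-; rewrite hE.
rewrite sumr_const mulr_natl; congr (_ *+ _).
rewrite /stirling1 cardsE; apply: eq_card => s.
by rewrite !unfold_in -hE.
Qed.

(** * Stirling numbers of the second kind *)

Lemma card_partition_le (T : finType) (Q : {set {set T}}) :
  finset.partition Q [set: T]%SET -> (#|Q| <= #|T|)%N.
Proof.
move=> /preim_partition_pblock <-; rewrite -cardsT; exact: leq_imset_card.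
Qed.

(** Functions with fibre partition [Q] are the injective functions on the blocks: [F] composes with
    the block map [b], and the representatives [rp] invert it. *)
Lemma card_preim_partition_eq (T U : finType) (Q : {set {set T}}) :
  finset.partition Q [set: T]%SET ->
  #|[set f : {ffun T -> U} | preim_partition f [set: T] == Q]%SET| =
  (#|U| ^_ #|Q|)%N.
Proof.
move=> QT; have /and3P[/eqP covQ trivQ Q0] := QT.
pose S := {B : {set T} | B \in Q}.
have blk v : finset.pblock Q v \in Q by rewrite finset.pblock_mem ?covQ ?inE.
pose b v : S := exist _ (finset.pblock Q v) (blk v).
pose F (g : {ffun S -> U}) := [ffun v => g (b v)].
have ex (B : S) : exists v, v \in val B.
  by apply/set0Pn; apply: contraNneq Q0 => <-; exact: (valP B).
pose rp (B : S) := xchoose (ex B).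
have rpB B : rp B \in val B by exact: xchooseP.
have bE (B : S) v : v \in val B -> b v = B.
  by move=> vB; apply: val_inj => /=; rewrite (finset.def_pblock trivQ (valP B) vB).
have -> : #|Q| = #|{: S}| by rewrite card_sig; apply: eq_card.
rewrite -card_inj_ffuns.
have F_inj : injective F.
  move=> g g' /ffunP eqF; apply/ffunP => B.
  by have := eqF (rp B); rewrite !ffunE (bE B).
rewrite -(card_imset _ F_inj); apply: eq_card => f; rewrite inE.
apply/eqP/imsetP => [fQ|[g]]; last first.
  rewrite inE => /injectiveP g_inj ->.
  rewrite -[RHS](finset.preim_partition_pblock QT); apply: eq_imset => x.
  apply/setP => y; rewrite !inE !ffunE; apply/eqP/eqP => [/g_inj [] //|E].
  by congr (g _); apply: val_inj.
have pE x : finset.pblock Q x = [set y | f x == f y]%SET.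
  have eqf : {in [set: T]%SET & &, equivalence_rel (fun x y => f x == f y)}.
    by move=> u v w _ _ _; split=> // /eqP ->.
  apply/setP => y; rewrite -fQ finset.pblock_equivalence_partition ?inE//.
exists [ffun B => f (rp B)].
  rewrite inE; apply/injectiveP => B B'; rewrite !ffunE => E.
  have : rp B' \in finset.pblock Q (rp B) by rewrite pE inE E.
  rewrite (finset.def_pblock trivQ (valP B) (rpB B)) => h.
  by rewrite -(bE _ _ h) (bE _ _ (rpB B')).
apply/ffunP => v; rewrite !ffunE; apply/eqP.
by have := rpB (b v); rewrite /= pE inE.
Qed.

(** All functions from ['I_n] to ['I_x] are sorted by the partition into fibres, then by its number
    of blocks. *)
Lemma expn_sum_stirling2 (x n : nat) :
  (x ^ n = \sum_(k < n.+1) stirling2 n k * x ^_ k)%N.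
Proof.
have -> : (x ^ n = #|{ffun 'I_n -> 'I_x}|)%N by rewrite card_ffun !card_ord.
rewrite -sum1_card.
rewrite (partition_big (fun f : {ffun 'I_n -> 'I_x} =>
  preim_partition f [set: 'I_n]%SET)
  (fun Q => finset.partition Q [set: 'I_n]%SET)) /=; last first.
  by move=> f _; exact: preim_partitionP.
pose h (Q : {set {set 'I_n}}) : 'I_n.+1 := inord #|Q|.
rewrite (partition_big h xpredT) //=; apply: eq_bigr => k _.
rewrite /stirling2 -sum1_card big_distrl /=; apply: eq_big => [Q|Q].
  rewrite inE; case: (boolP (finset.partition _ _)) => //= QT.
  by rewrite -val_eqE /= inordK // ltnS -[X in (_ <= X)%N]card_ord card_partition_le.
move=> /andP[QT /eqP <-]; rewrite mul1n sum1dep_card.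
rewrite card_preim_partition_eq // card_ord inordK // ltnS.
by rewrite -[X in (_ <= X)%N]card_ord card_partition_le.
Qed.

Lemma stirling2_small n k : (n < k)%N -> stirling2 n k = 0%N.
Proof.
move=> nk; apply/eqP; rewrite cards_eq0; apply/eqP/setP => Q; rewrite !inE.
apply/negbTE/negP => /andP[/card_partition_le + /eqP Qk].
by rewrite Qk card_ord leqNgt nk.
Qed.

(** Multiplied by i! (m - i)!, both sides become (j + m)!. *)
Lemma mul_bin_ffact j m i : (i <= m)%N ->
  ('C(j + m, j + i) * (j + i) ^_ j = (j + m) ^_ j * 'C(m, i))%N.
Proof.
move=> im; apply/eqP.
rewrite -(eqn_pmul2r (fact_gt0 i)) -(eqn_pmul2r (fact_gt0 (m - i))); apply/eqP.
have H1 : ((j + i) ^_ j * i`! = (j + i)`!)%N.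
  by have := ffact_fact (leq_addr i j); rewrite addKn.
have H2 : ((j + m) ^_ j * m`! = (j + m)`!)%N.
  by have := ffact_fact (leq_addr m j); rewrite addKn.
have H3 : ('C(j + m, j + i) * ((j + i)`! * (m - i)`!) = (j + m)`!)%N.
  have jim : (j + i <= j + m)%N by rewrite leq_add2l.
  by have := bin_fact jim; rewrite subnDl.
rewrite -[LHS]mulnA -mulnA [(_ * (i`! * _))%N]mulnA H1 H3 -H2.
by rewrite -(bin_fact im) !mulnA.
Qed.

(* The [k]-th finite difference at 0 of the falling factorial [x ^_ j]. *)
Lemma alt_sum_ffact (A : comNzRingType) k j :
  \sum_(i < k.+1) (-1) ^+ (k - i) * 'C(k, i)%:R * (i ^_ j)%:R =
  (k`! * (j == k))%:R :> A.
Proof.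
have [kj|jk] := ltnP k j.
  rewrite big1 => [|i _]; last first.
    by rewrite ffact_small ?mulr0// (leq_ltn_trans _ kj)// -ltnS.
  by rewrite (gtn_eqF kj) muln0.
rewrite -(subnKC jk); set m := (k - j)%N.
rewrite -(big_mkord xpredT (fun i => (-1) ^+ (j + m - i) * 'C(j + m, i)%:R *
  (i ^_ j)%:R)) (big_cat_nat (leq0n j)) /=; last first.
  by rewrite -addnS leq_addr.
rewrite big_nat big1 ?add0r; last first.
  by move=> i /andP[_ ij]; rewrite ffact_small ?mulr0.
rewrite -{1}[j]add0n big_addn -addnS addKn big_mkord.
(* The terms below [j] have vanished; after the shift by [j] the sum is [(j + m) ^_ j] times (1 -
   1)^m, which is nonzero only for m = 0. *)
rewrite (eq_bigr (fun i : 'I_m.+1 => ((j + m) ^_ j)%:R *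
    ((-1) ^+ (m - i) * 1 ^+ i *+ 'C(m, i)))); last first.
  move=> i _; rewrite [(i + j)%N]addnC subnDl -mulrA -natrM.
  rewrite (mul_bin_ffact _ (ltnSE (ltn_ord i))).
  by rewrite expr1n mulr1 natrM -[X in _ = _ * X]mulr_natr mulrCA.
rewrite -big_distrr /= -exprDn addNr expr0n -natrM.
have [->|m0] := eqVneq m 0%N; first by rewrite addn0 eqxx ffactnn.
by rewrite -[X in (X == _)%N]addn0 eqn_add2l eq_sym (negbTE m0) !muln0.
Qed.

(** With i^n written in falling factorials, [alt_sum_ffact] keeps only the order j = k. If k > n
    this order does not occur, and [stirling2 n k] is 0 too. *)
Lemma stirling2_explicit (A : comNzRingType) n k :
  \sum_(i < k.+1) (-1) ^+ (k - i) * 'C(k, i)%:R * i%:R ^+ n =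
  (k`! * stirling2 n k)%:R :> A.
Proof.
rewrite (eq_bigr (fun i : 'I_k.+1 => \sum_(j < n.+1)
   (stirling2 n j)%:R * ((-1) ^+ (k - i) * 'C(k, i)%:R * (i ^_ j)%:R))); last first.
  move=> i _; rewrite -natrX expn_sum_stirling2 natr_sum big_distrr /=.
  by apply: eq_bigr => j _; rewrite natrM; ring.
rewrite exchange_big /=.
rewrite (eq_bigr (fun j : 'I_n.+1 => (stirling2 n j * (k`! * (j == k :> nat)))%:R));
  last by move=> j _; rewrite -big_distrr /= alt_sum_ffact -natrM.
have [kn|nk] := ltnP k n.+1.
  rewrite (bigD1 (Ordinal kn)) //= eqxx muln1 mulnC big1 ?addr0// => j.
  by rewrite -val_eqE /= => /negbTE ->; rewrite !muln0.
rewrite stirling2_small// muln0 big1// => j _.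
by rewrite (ltn_eqF (leq_trans (ltn_ord j) nk)) !muln0.
Qed.

(** * The r-Stirling numbers and the alternating sum *)

Section RStirling.
Variables (R : realType) (r : R).

(** Summing over [j] first gives (x + r)^l by the binomial theorem: the parameter only translates
    the argument of the rising factorial. *)
Lemma sum_rstirling1 n (x : R[i]) :
  \sum_(j < n.+1) (rstirling1 n j r)%:C * x ^+ j = rising (x + r%:C) n.
Proof.
rewrite -sum_stirling1.
rewrite (eq_bigr (fun j : 'I_n.+1 => \sum_(l < n.+1 | (j <= l)%N)
   (stirling1 n l)%:R * ('C(l, j)%:R * r%:C ^+ (l - j) * x ^+ j))); last first.
  move=> j _; rewrite /rstirling1 rmorph_sum /= big_distrl /=.
  rewrite (big_nat_widenl _ 0) // big_mkord; apply: eq_big => //= l _.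
  by rewrite !rmorphM /= rmorphXn /= !rmorph_nat !mulrA.
rewrite (exchange_big_dep xpredT) //=; apply: eq_bigr => l _.
rewrite -big_distrr /=; congr (_ * _).
rewrite addrC exprDn (big_ord_widen n.+1 (fun j =>
  r%:C ^+ (l - j) * x ^+ j *+ 'C(l, j))) //.
apply: eq_big => [j|j _]; first by rewrite ltnS.
by rewrite -[RHS]mulr_natl mulrA.
Qed.

Lemma rstirling2_explicit n k :
  k`!%:R * rstirling2 n k r =
  \sum_(i < k.+1) (-1) ^+ (k - i) * 'C(k, i)%:R * (i%:R + r) ^+ n.
Proof.
rewrite /rstirling2 (big_nat_widenl _ 0) // big_mkord /=.
rewrite [X in _ * X]big_mkcond /= big_distrr /=.
rewrite (eq_bigr (fun j : 'I_n.+1 => \sum_(i < k.+1)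
  (-1) ^+ (k - i) * 'C(k, i)%:R * (r ^+ (n - j) * i%:R ^+ j *+ 'C(n, j)))).
  rewrite exchange_big /=; apply: eq_bigr => i _.
  by rewrite -big_distrr /= addrC exprDn.
move=> j _; transitivity ('C(n, j)%:R * r ^+ (n - j) * (k`! * stirling2 j k)%:R).
  case: leqP => [_|jk]; first by rewrite natrM; ring.
  by rewrite stirling2_small// muln0 !mulr0.
rewrite -stirling2_explicit big_distrr /=; apply: eq_bigr => i _.
by rewrite -mulr_natl; ring.
Qed.

(** The alternating sum for [rstirling2] makes the dependence on [j] geometric, ((i + r) u)^j, so
    the sum over [j] is the generating polynomial of [rstirling1]. The indices j < k can be added
    because [rstirling2 j k r] is then an empty sum. *)
Lemma sum_rlah n k (u : R[i]) :
  k`!%:R * (\sum_(k <= j < n.+1)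
    (rstirling1 n j r * rstirling2 j k r)%:C * u ^+ j) =
  \sum_(i < k.+1) (-1) ^+ (k - i) * 'C(k, i)%:R *
    rising ((i%:R + r)%:C * u + r%:C) n.
Proof.
rewrite (big_nat_widenl _ 0) // big_mkord /= big_mkcond /= big_distrr /=.
rewrite (eq_bigr (fun j : 'I_n.+1 => \sum_(i < k.+1)
    (-1) ^+ (k - i) * 'C(k, i)%:R * ((rstirling1 n j r)%:C *
      ((i%:R + r)%:C * u) ^+ j))); last first.
  move=> j _.
  transitivity ((rstirling1 n j r)%:C * u ^+ j * (k`!%:R * rstirling2 j k r)%:C).
    case: leqP => [_|jk]; first by rewrite !rmorphM /= !rmorph_nat; ring.
    by rewrite /rstirling2 big_geq// rmorphM /= rmorph0 !mulr0.
  rewrite rstirling2_explicit; move: (rstirling1 n j r) => c.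
  rewrite rmorph_sum /= big_distrr /=; apply: eq_bigr => i _.
  rewrite !rmorphM /= !rmorphXn /= !rmorph_nat rmorphN1 exprMn; ring.
rewrite exchange_big /=; apply: eq_bigr => i _.
by rewrite -big_distrr /= sum_rstirling1.
Qed.

End RStirling.

(** * Complex modulus and exponential *)

Section ComplexModulus.
Variable R : realType.
Implicit Types (z w : R[i]) (x y : R).
Local Notation normc := (@Normc.normc R).
Local Notation Re := (@complex.Re R).
Local Notation Im := (@complex.Im R).

(** The norm of [R[i]] has values in [R[i]]; the estimates use the real-valued [normc], and this
    identity translates back. *)
Lemma normr_normc z : `|z| = (normc z)%:C.
Proof. by rewrite normc_def; case: z. Qed.

Lemma normc_ge0 z : 0 <= normc z.
Proof. by case: z => a b; rewrite sqrtr_ge0. Qed.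

Lemma normc_real x : normc x%:C = `|x|.
Proof. by rewrite /= expr0n addr0 sqrtr_sqr. Qed.

Lemma sqr_normc_ReIm z : normc z ^+ 2 = Re z ^+ 2 + Im z ^+ 2.
Proof. by case: z => a b /=; rewrite sqr_sqrtr// addr_ge0// sqr_ge0. Qed.

Lemma normc_Re_le z : `|Re z| <= normc z.
Proof.
by case: z => a b /=; rewrite -sqrtr_sqr ler_wsqrtr// lerDl sqr_ge0.
Qed.

Lemma normc_Im_le z : `|Im z| <= normc z.
Proof.
by case: z => a b /=; rewrite -sqrtr_sqr ler_wsqrtr// lerDr sqr_ge0.
Qed.

Lemma normc_le_ReIm z : normc z <= `|Re z| + `|Im z|.
Proof.
rewrite -(@ler_pXn2r _ 2)// ?nnegrE ?normc_ge0 ?addr_ge0//.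
rewrite sqr_normc_ReIm sqrrD !real_normK ?num_real// -addrA lerD2l lerDr.
by rewrite mulrn_wge0// mulr_ge0.
Qed.

Lemma normc_eq0 z : (normc z == 0) = (z == 0).
Proof.
by apply/eqP/eqP => [/Normc.eq0_normc//|->]; rewrite Normc.normc0.
Qed.

Lemma normcB_le z w : normc (z - w) <= normc z + normc w.
Proof. by rewrite -(normcN w) le_normcD. Qed.

Lemma normcX z n : normc (z ^+ n) = normc z ^+ n.
Proof.
elim: n => [|n IHn]; first by rewrite !expr0 Normc.normc1.
by rewrite !exprS Normc.normcM IHn.
Qed.

Lemma ReM_real x z : Re (x%:C * z) = x * Re z.
Proof. by case: z => a b /=; rewrite mul0r subr0. Qed.

Lemma ImM_real x z : Im (x%:C * z) = x * Im z.
Proof. by case: z => a b /=; rewrite mul0r addr0. Qed.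

Lemma ReD z w : Re (z + w) = Re z + Re w. Proof. by case: z; case: w. Qed.
Lemma ImD z w : Im (z + w) = Im z + Im w. Proof. by case: z; case: w. Qed.
Lemma ReN z : Re (- z) = - Re z. Proof. by case: z. Qed.
Lemma ImN z : Im (- z) = - Im z. Proof. by case: z. Qed.
Lemma ReM z w : Re (z * w) = Re z * Re w - Im z * Im w.
Proof. by case: z; case: w. Qed.
Lemma ImM z w : Im (z * w) = Re z * Im w + Im z * Re w.
Proof. by case: z; case: w. Qed.

Lemma Re_expC z : Re (expC z) = expR (Re z) * cos (Im z).
Proof. by rewrite /expC ReM_real. Qed.

Lemma Im_expC z : Im (expC z) = expR (Re z) * sin (Im z).
Proof. by rewrite /expC ImM_real. Qed.

Lemma expCD z w : expC (z + w) = expC z * expC w.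
Proof.
apply/eqP; rewrite eq_complex; apply/andP; split; apply/eqP.
  by rewrite Re_expC [RHS]ReM !Re_expC !Im_expC ReD ImD expRD cosD; ring.
by rewrite Im_expC [RHS]ImM !Re_expC !Im_expC ReD ImD expRD sinD; ring.
Qed.

Lemma expC_real x : expC x%:C = (expR x)%:C.
Proof. by rewrite /expC /= cos0 sin0 mulr1. Qed.

Lemma expC0 : expC (0 : R[i]) = 1.
Proof. by rewrite -(rmorph0 (real_complex R)) expC_real expR0. Qed.

Lemma normc_expC z : normc (expC z) = expR (Re z).
Proof.
rewrite /expC Normc.normcM normc_real ger0_norm ?expR_ge0//=.
by rewrite cos2Dsin2 sqrtr1 mulr1.
Qed.

Local Opaque expC.

Lemma expC_neq0 z : expC z != 0.
Proof. by rewrite -normc_eq0 normc_expC gt_eqF// expR_gt0. Qed.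

Lemma expCN z : expC (- z) = (expC z)^-1.
Proof.
apply: (mulfI (expC_neq0 z)); rewrite -expCD subrr expC0 divff//.
exact: expC_neq0.
Qed.

Lemma expCB z w : expC (z - w) = expC z / expC w.
Proof. by rewrite expCD expCN. Qed.

Lemma expC_natmul z n : expC (z * n%:R) = expC z ^+ n.
Proof.
elim: n => [|n IHn]; first by rewrite mulr0 expC0 expr0.
by rewrite -natr1 mulrDr mulr1 expCD IHn exprSr.
Qed.

Lemma normr_sin_le x : `|sin x| <= `|x|.
Proof.
wlog x0 : x / 0 <= x.
  move=> h; have [/h//|/ltW x0] := leP 0 x.
  by have := h (- x); rewrite sinN !normrN oppr_ge0; exact.
have [c _] := @MVT_segment R sin cos 0 x x0 (fun x _ => is_derive_sin x)
  (continuous_subspaceT (@continuous_sin R)).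
rewrite sin0 !subr0 => ->; rewrite normrM -[leRHS]mul1r.
by rewrite ler_wpM2r// cos_max.
Qed.

Lemma normr_1subcos_le x : `|cos x - 1| <= `|x|.
Proof.
wlog x0 : x / 0 <= x.
  move=> h; have [/h//|/ltW x0] := leP 0 x.
  by have := h (- x); rewrite cosN !normrN oppr_ge0; exact.
have [c _] := @MVT_segment R cos (fun x => - sin x) 0 x x0
  (fun x _ => is_derive_cos x)
  (continuous_subspaceT (@continuous_cos R)).
rewrite cos0 subr0 => ->; rewrite normrM normrN -[leRHS]mul1r.
by rewrite ler_wpM2r// sin_max.
Qed.

(** From 1 + y <= e^y, taken at y = -x when x >= 0 and at y = x when x < 0. *)
Lemma normr_expR_sub1_le x : `|expR x - 1| <= `|x| * (1 + expR x).
Proof.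
have [x0|x0] := leP 0 x.
  rewrite (ger0_norm x0) ger0_norm ?subr_ge0; last first.
    by rewrite leNgt expR_lt1 -leNgt.
  have := expR_ge1Dx (- x); rewrite expRN => h.
  have e0 := expR_gt0 x.
  have : (1 - x) * expR x <= 1.
    by rewrite -(@ler_pM2r _ (expR x)) ?mulVf ?gt_eqF// in h *.
  nra.
rewrite (ltr0_norm x0) ltr0_norm ?subr_lt0 ?expR_lt1//.
have := expR_ge1Dx x; have := expR_gt0 x; nra.
Qed.

(** Split e^z - 1 into e^(Re z) (e^(i Im z) - 1) and e^(Re z) - 1. The factor e^(i Im z) - 1 is at
    most 2 |z|, and 3 = 2 + 1. *)
Lemma normc_expC_sub1_le z :
  normc (expC z - 1) <= 3 * normc z * (1 + expR (Re z)).
Proof.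
have -> : expC z - 1 = (expR (Re z))%:C *
    ((cos (Im z) - 1) +i* sin (Im z)) + (expR (Re z) - 1)%:C.
  apply/eqP; rewrite eq_complex ReD ImD Re_expC Im_expC /=.
  by apply/andP; split; apply/eqP; ring.
apply: (le_trans (le_normcD _ _)).
rewrite Normc.normcM !normc_real (ger0_norm (expR_ge0 _)).
have h1 : normc ((cos (Im z) - 1) +i* sin (Im z)) <= 2 * normc z.
  apply: (le_trans (normc_le_ReIm _)) => /=.
  have := normr_sin_le (Im z); have := normr_1subcos_le (Im z).
  have := normc_Im_le z; lra.
have h2 := normr_expR_sub1_le (Re z).
have h3 : `|Re z| * (1 + expR (Re z)) <= normc z * (1 + expR (Re z)).
  by rewrite ler_wpM2r ?normc_Re_le// addr_ge0// expR_ge0.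
have h4 := ler_wpM2l (expR_ge0 (Re z)) h1.
have := normc_ge0 z; have := expR_gt0 (Re z); nra.
Qed.

(** For x < 1/2 the left side is at most 2 while |x - 1| > 1/2, whence the 4. For x >= 1/2 one has
    |ln x| <= 2 |x - 1| and |x^s| <= 1 + x^M, and the preceding bound gives 3 * 2 M |x - 1| (2 +
    x^M), whence the 12. *)
Lemma normc_cpow_sub1_le (M : nat) (s : R[i]) x :
  0 < x -> 0 <= Re s -> normc s <= M%:R ->
  normc (expC (s * (ln x)%:C) - 1) <=
    (12 * M%:R + 4) * (`|x - 1| * (1 + x ^+ M)).
Proof.
move=> x0 s0 sM.
have M0 : 0 <= M%:R :> R by [].
have xM : 0 < x ^+ M by rewrite exprn_gt0.
have ReE : Re (s * (ln x)%:C) = Re s * ln x by rewrite mulrC ReM_real mulrC.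
have [x2|x2] := ltP x 2^-1.
  have lx : ln x <= 0 by rewrite ln_le0//; lra.
  apply: (@le_trans _ _ 2).
    apply: (le_trans (normcB_le _ _)); rewrite Normc.normc1 normc_expC ReE.
    have : expR (Re s * ln x) <= 1 by rewrite expR_le1 mulr_ge0_le0.
    by lra.
  rewrite ltr0_norm ?subr_lt0; last by lra.
  have : 0 <= M%:R * (- (x - 1) * (1 + x ^+ M)).
    by apply: mulr_ge0 => //; apply: mulr_ge0; lra.
  nra.
have lnx : `|ln x| <= 2 * `|x - 1|.
  have [x1|x1] := leP 1 x.
    rewrite (ger0_norm (ln_ge0 x1)) ger0_norm ?subr_ge0//.
    have := @le_ln1Dx _ (x - 1); rewrite [1 + _]addrC subrK => /(_ _); lra.
  have ? : ln x < 0 by rewrite ln_lt0// x0.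
  rewrite (@ltr0_norm _ (ln x))// ltr0_norm ?subr_lt0//.
  have := @le_ln1Dx _ (x^-1 - 1).
  rewrite [1 + _]addrC subrK lnV ?posrE// => /(_ _) h.
  have xi : x^-1 <= 2 by rewrite -[2]invrK lef_pV2 ?posrE// invr_gt0.
  have xx : x^-1 * x = 1 by rewrite mulVf// gt_eqF.
  have xi0 : 0 < x^-1 by rewrite invr_gt0.
  apply: le_trans (h _) _; first by lra.
  nra.
have xa : expR (Re s * ln x) <= 1 + x ^+ M.
  have [x1|x1] := leP 1 x.
    rewrite -{2}(lnK x0) -expRM_natl -[leLHS]add0r lerD// ler_expR.
    rewrite mulrC [leRHS]mulrC ler_wpM2l ?ln_ge0//.
    by apply: le_trans sM; apply: le_trans (normc_Re_le _); rewrite ler_norm.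
  have ? : ln x <= 0 by rewrite ln_le0// ltW.
  have : expR (Re s * ln x) <= 1 by rewrite expR_le1 mulr_ge0_le0.
  lra.
apply: (le_trans (normc_expC_sub1_le _)).
rewrite ReE Normc.normcM normc_real.
have h1 : normc s * `|ln x| <= M%:R * (2 * `|x - 1|).
  by rewrite ler_pM// normc_ge0.
have d0 : 0 <= `|x - 1| by [].
have h2 : normc s * `|ln x| * (1 + expR (Re s * ln x)) <=
   M%:R * (2 * `|x - 1|) * (2 + x ^+ M).
  rewrite ler_pM ?mulr_ge0 ?normc_ge0 ?addr_ge0 ?expR_ge0//; lra.
have h3 : 0 <= M%:R * `|x - 1| by rewrite mulr_ge0.
nra.
Qed.

End ComplexModulus.

(** * Integration over the half line *)

Section HalfLine.
Variable R : realType.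
Local Notation mu := (@lebesgue_measure R).

Local Notation halfline := (`]0%R, +oo[%classic : set R).

(** Compact intervals filling the half line, which treat both improper ends at once. The shift by 2
    keeps the end points distinct even for m = 0. *)
Definition exhaust (m : nat) : set R := `[m.+2%:R^-1, m.+2%:R].

Lemma exhaust_gt0 m x : exhaust m x -> 0 < x.
Proof.
rewrite /exhaust /= in_itv /= => /andP[h _]; apply: lt_le_trans h.
by rewrite invr_gt0.
Qed.

Lemma measurable_exhaust m : measurable (exhaust m).
Proof. exact: measurable_itv. Qed.

Lemma exhaust_bounds m : (m.+2%:R^-1 : R) < m.+2%:R.
Proof. by rewrite (@lt_trans _ _ 1)// ?invf_lt1// ltr1n. Qed.

Lemma exhaust_subset m : exhaust m `<=` `]0, +oo[.
Proof. by move=> x /exhaust_gt0 x0; rewrite /= in_itv /= x0. Qed.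

Lemma exhaustS m n : (m <= n)%N -> exhaust m `<=` exhaust n.
Proof.
move=> mn x; rewrite /exhaust /= !in_itv /= => /andP[h1 h2].
have mn2 : m.+2%:R <= n.+2%:R :> R by rewrite ler_nat.
rewrite (le_trans _ h1) ?(le_trans h2)//.
by rewrite lef_pV2 ?posrE.
Qed.

Lemma near_exhaust x : 0 < x -> \forall m \near \oo, exhaust m x.
Proof.
move=> x0; near=> m; rewrite /exhaust /= in_itv /=; apply/andP; split.
  rewrite -[leRHS]invrK lef_pV2 ?posrE ?invr_gt0//.
  rewrite (@le_trans _ _ m%:R)// ?ler_nat//; last by rewrite -addn2 leq_addr.
  by near: m; exact: nbhs_infty_ger.
rewrite (@le_trans _ _ m%:R)// ?ler_nat//; last by rewrite -addn2 leq_addr.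
by near: m; exact: nbhs_infty_ger.
Unshelve. all: by end_near. Qed.

Lemma integral_exhaust (f F : R -> R) m :
  (forall x : R, 0 < x -> {for x, continuous f}) ->
  (forall x : R, 0 < x -> is_derive x 1 F (f x)) ->
  (\int[mu]_(x in exhaust m) (f x)%:E = (F m.+2%:R - F m.+2%:R^-1)%:E)%E.
Proof.
move=> cf dF.
have cF (x : R) : 0 < x -> F y @[y --> x] --> F x.
  move=> x0; apply: differentiable_continuous; apply/derivable1_diffP.
  by have [] := dF x x0.
apply: continuous_FTC2.
- exact: exhaust_bounds.
- apply: continuous_in_subspaceT => x; rewrite inE => /(@exhaust_gt0 m).
  exact: cf.
- split.
  + move=> x; rewrite in_itv /= => /andP[h _].
    by have [] := dF x (lt_trans (_ : 0 < m.+2%:R^-1) h); rewrite ?invr_gt0.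
  + by apply: cvg_at_right_filter; apply: cF; rewrite invr_gt0.
  + by apply: cvg_at_left_filter; apply: cF.
- move=> x; rewrite in_itv /= => /andP[h _]; rewrite derive1E.
  by have [] := dF x (lt_trans (_ : 0 < m.+2%:R^-1) h); rewrite ?invr_gt0.
Qed.

Lemma cvg_restrict_exhaust (f : R -> R) x : 0 < x ->
  ((EFin \o f) \_ (exhaust m)) x @[m --> \oo] --> (f x)%:E.
Proof.
move=> x0; apply: cvg_near_cst; near=> m; rewrite patchE ifT// inE.
by near: m; exact: near_exhaust.
Unshelve. all: by end_near. Qed.

Lemma integral_restrict_exhaust (f : R -> R) m :
  (\int[mu]_(x in `]0%R, +oo[) ((EFin \o f) \_ (exhaust m)) x =
   \int[mu]_(x in exhaust m) (f x)%:E)%E.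
Proof.
rewrite -integral_mkcondr; congr integral.
exact/setIidPr/exhaust_subset.
Qed.

Lemma measurable_restrict_exhaust (g : R -> \bar R) m :
  measurable_fun halfline g -> measurable_fun halfline (g \_ (exhaust m)).
Proof.
move=> mg; apply/measurable_restrict => //; first exact: measurable_exhaust.
exact: measurable_funS mg.
Qed.

Lemma cvg_integral_exhaust (f : R -> R) :
  mu.-integrable halfline (EFin \o f) ->
  (\int[mu]_(x in exhaust m) (f x)%:E @[m --> \oo] -->
   \int[mu]_(x in `]0%R, +oo[) (f x)%:E)%E.
Proof.
move=> fi.
have mf : measurable_fun halfline f.
  by apply/measurable_EFinP; exact: measurable_int fi.
under eq_fun do rewrite -integral_restrict_exhaust.
have := @dominated_cvg _ _ _ mu halfline (measurable_itv _)
  (fun m => (EFin \o f) \_ (exhaust m)) (EFin \o f) (abse \o (EFin \o f)).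
apply.
- by move=> n; apply: measurable_restrict_exhaust; apply/measurable_EFinP.
- move=> x; rewrite /= in_itv /= andbT; exact: cvg_restrict_exhaust.
- by [].
- exact: integrable_abse.
- by move=> m x _; rewrite patchE; case: ifP => //= _; rewrite normr0 lee_fin.
Qed.

(** Monotone convergence: the integral over [exhaust m] is a difference of two values of [H], hence
    at most 2 B. This produces the integrable majorant of the Gamma integrand. *)
Lemma ge0_integrable_primitive (h H : R -> R) (B : R) :
  (forall x : R, 0 < x -> {for x, continuous h}) ->
  (forall x : R, 0 < x -> is_derive x 1 H (h x)) ->
  (forall x : R, 0 < x -> 0 <= h x) -> (forall x, `|H x| <= B) ->
  measurable_fun halfline h ->
  mu.-integrable halfline (EFin \o h).
Proof.
move=> ch dH h0 HB mh; apply/integrableP; split; first exact/measurable_EFinP.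
have -> : (\int[mu]_(x in halfline) `|(EFin \o h) x| =
    \int[mu]_(x in halfline) limn (fun m => ((EFin \o h) \_ (exhaust m)) x))%E.
  apply: eq_integral => x; rewrite inE /= in_itv /= andbT => x0.
  by rewrite (cvg_lim _ (@cvg_restrict_exhaust h _ x0))// ger0_norm// h0.
have nneg m x : halfline x -> (0 <= ((EFin \o h) \_ (exhaust m)) x)%E.
  rewrite /= in_itv /= andbT => x0.
  by rewrite patchE; case: ifP => //= _; rewrite lee_fin h0.
have nd x : halfline x -> {homo (fun m => ((EFin \o h) \_ (exhaust m)) x) :
    m n / (m <= n)%N >-> (m <= n)%E}.
  move=> x0 m n mn; rewrite !patchE; case: ifPn => [|_]; last first.
    by have := nneg n x x0; rewrite patchE.
  by rewrite inE => /(exhaustS mn) xn; rewrite ifT ?inE.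
have emh : measurable_fun halfline (EFin \o h) by exact/measurable_EFinP.
have hc := @cvg_monotone_convergence _ _ _ mu _ (measurable_itv `]0, +oo[)
  (fun m => (EFin \o h) \_ (exhaust m))
  (fun m => measurable_restrict_exhaust m emh) nneg nd.
rewrite -(cvg_lim _ hc)//.
apply: (@le_lt_trans _ _ (B + B)%:E); last by rewrite ltry.
apply: lime_le; first exact: cvgP hc.
apply: nearW => m; rewrite integral_restrict_exhaust (integral_exhaust _ ch dH).
rewrite lee_fin; have := HB m.+2%:R; have := HB (m.+2%:R^-1).
by rewrite !ler_norml => /andP[h1 h2] /andP[h3 h4]; lra.
Qed.

Lemma Rintegral_derive (f F : R -> R) (l1 l0 : R) :
  (forall x : R, 0 < x -> {for x, continuous f}) ->
  (forall x : R, 0 < x -> is_derive x 1 F (f x)) ->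
  mu.-integrable halfline (EFin \o f) ->
  F m.+2%:R @[m --> \oo] --> l1 -> F m.+2%:R^-1 @[m --> \oo] --> l0 ->
  \int[mu]_(x in `]0, +oo[) f x = l1 - l0.
Proof.
move=> cf dF fi Fy F0; rewrite /Rintegral.
have h1 := cvg_integral_exhaust fi.
have h2 : (\int[mu]_(x in exhaust m) (f x)%:E @[m --> \oo] --> (l1 - l0)%:E)%E.
  under eq_fun do rewrite (integral_exhaust _ cf dF).
  apply: cvg_EFin; first by apply: nearW.
  exact: cvgB Fy F0.
by rewrite -(cvg_lim _ h1)// (cvg_lim _ h2).
Qed.

End HalfLine.

(** * The Gamma function *)

Section GammaIntegrand.
Variable R : realType.
Local Notation mu := (@lebesgue_measure R).
Local Notation halfline := (`]0%R, +oo[%classic : set R).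
Implicit Types a b c t : R.

Lemma expR_natln (N : nat) t : 0 < t -> expR (N%:R * ln t) = t ^+ N.
Proof. by move=> t0; rewrite expRM_natl lnK. Qed.

Lemma near_expR_Nln (e eps : R) : 0 < e -> 0 < eps ->
  \forall n \near \oo, expR (- e * ln n%:R) < eps.
Proof.
move=> e0 eps0; near=> n.
have n0 : expR (- ln eps / e) < n%:R by near: n; exact: nbhs_infty_gtr.
rewrite -[ltRHS](lnK eps0) ltr_expR mulNr ltrNl mulrC -ltr_pdivrMr//.
by rewrite -(expRK (_ / _)) ltr_ln ?posrE ?expR_gt0// (lt_trans _ n0)// expR_gt0.
Unshelve. all: by end_near. Qed.

(** For t >= 1, t^c <= t^(N+1) <= (N+1)! e^t by one term of the exponential series; for t < 1 the
    value is at most 1. *)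
Lemma expR_ln_bounded c : 0 <= c -> exists2 K : R, 0 < K &
  forall t, 0 < t -> expR (c * ln t - t) <= K.
Proof.
move=> c0; set N := Num.trunc c.
have cN : c < N.+1%:R by exact: truncnS_gt.
have f1 : 1 <= (N.+1)`!%:R :> R by rewrite ler1n fact_gt0.
exists (N.+1)`!%:R => [|t t0]; first exact: lt_le_trans f1.
have [t1|t1] := leP 1 t; last first.
  apply: le_trans f1; rewrite expR_le1 subr_le0 (le_trans _ (ltW t0))//.
  by rewrite mulr_ge0_le0// ln_le0// ltW.
apply: (@le_trans _ _ (t ^+ N.+1 * expR (- t))).
  rewrite -expR_natln// -expRD ler_expR lerD2r ler_wpM2r ?ln_ge0//.
  exact: ltW.
rewrite expRN ler_pdivrMr ?expR_gt0// mulrC -ler_pdivrMr; last first.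
  exact: lt_le_trans f1.
have := expR_ge1Dxn N (ltW t0); lra.
Qed.

(** Real part of t^(a + i b) e^(-t). The exponent is not lowered by 1, so the integrand of Gamma(s)
    has a = Re s - 1 and its antiderivatives by parts stay in the same family. *)
Definition gamma_Re a b t := expR (a * ln t - t) * cos (b * ln t).
Definition gamma_Im a b t := expR (a * ln t - t) * sin (b * ln t).

Lemma expR_ln_pred a t : 0 < t ->
  expR ((a - 1) * ln t - t) = expR (a * ln t - t) / t.
Proof.
move=> t0; rewrite -[X in _ / X](lnK t0) -expRN -expRD; congr expR; ring.
Qed.

Lemma is_derive_mulln c t : 0 < t ->
  is_derive t 1 (fun x => c * ln x) (c / t).
Proof.
move=> t0; have h := is_derive1_ln t0.
exact: (is_deriveZ c h).
Qed.

Lemma is_derive_expR_ln a t : 0 < t ->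
  is_derive t 1 (fun x => expR (a * ln x - x))
    (expR (a * ln t - t) * (a / t - 1)).
Proof.
move=> t0; have h := is_derive_mulln a t0.
have h2 : is_derive t 1 (fun x => a * ln x - x) (a / t - 1).
  exact: (is_deriveB h (is_derive_id t 1)).
exact: (is_derive1_comp (is_derive_expR _) h2).
Qed.

Lemma is_derive_cos_ln b t : 0 < t ->
  is_derive t 1 (fun x => cos (b * ln x)) (- sin (b * ln t) * (b / t)).
Proof.
move=> t0; exact: (is_derive1_comp (is_derive_cos _) (is_derive_mulln b t0)).
Qed.

Lemma is_derive_sin_ln b t : 0 < t ->
  is_derive t 1 (fun x => sin (b * ln x)) (cos (b * ln t) * (b / t)).
Proof.
move=> t0; exact: (is_derive1_comp (is_derive_sin _) (is_derive_mulln b t0)).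
Qed.

(** Real part of (t^s e^(-t))' = s t^(s-1) e^(-t) - t^s e^(-t) for s = a + i b. *)
Lemma is_derive_gamma_Re a b t : 0 < t ->
  is_derive t 1 (gamma_Re a b)
    (a * gamma_Re (a - 1) b t - gamma_Re a b t - b * gamma_Im (a - 1) b t).
Proof.
move=> t0; apply: (is_derive_eq
  (is_deriveM (is_derive_expR_ln a t0) (is_derive_cos_ln b t0))).
rewrite /gamma_Re /gamma_Im (expR_ln_pred a t0) /GRing.scale /=.
by field; rewrite gt_eqF.
Qed.

Lemma is_derive_gamma_Im a b t : 0 < t ->
  is_derive t 1 (gamma_Im a b)
    (a * gamma_Im (a - 1) b t - gamma_Im a b t + b * gamma_Re (a - 1) b t).
Proof.
move=> t0; apply: (is_derive_eq
  (is_deriveM (is_derive_expR_ln a t0) (is_derive_sin_ln b t0))).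
rewrite /gamma_Re /gamma_Im (expR_ln_pred a t0) /GRing.scale /=.
by field; rewrite gt_eqF.
Qed.

Lemma is_derive_continuous (f : R -> R) t df :
  is_derive t 1 f df -> {for t, continuous f}.
Proof.
by move=> [d _]; apply: differentiable_continuous; exact/derivable1_diffP.
Qed.

Lemma continuous_gamma_Re a b t : 0 < t -> {for t, continuous (gamma_Re a b)}.
Proof. by move=> /(is_derive_gamma_Re a b) /is_derive_continuous. Qed.

Lemma continuous_gamma_Im a b t : 0 < t -> {for t, continuous (gamma_Im a b)}.
Proof. by move=> /(is_derive_gamma_Im a b) /is_derive_continuous. Qed.

Lemma measurable_halfline (f : R -> R) :
  (forall t, 0 < t -> {for t, continuous f}) -> measurable_fun halfline f.
Proof.
move=> cf; apply: open_continuous_measurable_fun => // t.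
by rewrite inE /= in_itv /= andbT => /cf.
Qed.

Lemma integrable_expR_ln a : 0 < a ->
  mu.-integrable halfline (EFin \o (fun t => expR ((a - 1) * ln t - t))).
Proof.
move=> a0.
(* [g] is the derivative of the bounded function atan(t^a), that is a t^(a-1) / (1 + t^(2a)):
   integrable at both ends, with the right singularity at 0. *)
pose g t := (1 + expR (a * ln t) ^+ 2)^-1 * (a * expR (a * ln t) / t).
have g2 t : 0 < 1 + expR (a * ln t) ^+ 2 by rewrite ltr_wpDr// sqr_ge0.
have cg t : 0 < t -> {for t, continuous g}.
  move=> t0.
  have ce : {for t, continuous (fun x => expR (a * ln x))}.
    apply: is_derive_continuous.
    exact: (is_derive1_comp (is_derive_expR _) (is_derive_mulln a t0)).
  apply: cvgM; last first.
    apply: cvgM; first by apply: cvgM => //; exact: cvg_cst.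
    by apply: cvgV; [rewrite gt_eqF|exact: cvg_id].
  apply: cvgV; first by rewrite gt_eqF.
  by apply: cvgD; [exact: cvg_cst|rewrite expr2; exact: cvgM].
have mg := measurable_halfline cg.
have gi : mu.-integrable halfline (EFin \o g).
  apply: (@ge0_integrable_primitive _ g (fun t => atan (expR (a * ln t))) (pi / 2))
    => // [t t0|t t0|t].
  - apply: (is_derive_eq (is_derive1_comp (is_derive1_atan _)
      (is_derive1_comp (is_derive_expR _) (is_derive_mulln a t0)))).
    by rewrite /g /=; congr (_ * _); ring.
  - apply: mulr_ge0; first by rewrite invr_ge0 ltW.
    by apply: divr_ge0 (ltW t0); rewrite mulr_ge0 ?expR_ge0 ?ltW.
  - by rewrite ler_norml !ltW ?atan_ltpi2 ?atan_gtNpi2.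
(* As t^(2a) e^(-t) <= K, one has e^(-t) (1 + t^(2a)) <= 1 + K, so the integrand is at most (1 + K)
   / a times [g]. *)
have [K K0 hK] := @expR_ln_bounded (2 * a) (mulr_ge0 (ler0n _ _) (ltW a0)).
have cf t : 0 < t -> {for t, continuous (fun t => expR ((a - 1) * ln t - t))}.
  by move=> t0; apply: is_derive_continuous (is_derive_expR_ln _ t0).
have mf := measurable_halfline cf.
apply: (@le_integrable _ _ _ mu halfline _ _
    (fun t => ((1 + K) / a)%:E * (EFin \o g) t)%E).
- by [].
- exact/measurable_EFinP.
- move=> t; rewrite /= in_itv /= andbT => t0.
  rewrite lee_fin ger0_norm ?expR_ge0// (le_trans _ (ler_norm _))//.
  rewrite expR_ln_pred// /g.
  have -> : (1 + K) / a * ((1 + expR (a * ln t) ^+ 2)^-1 * (a * expR (a * ln t) / t)) =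
      ((1 + K) / (1 + expR (a * ln t) ^+ 2) * expR (a * ln t)) / t.
    by field; rewrite !gt_eqF ?g2.
  rewrite ler_wpM2r ?invr_ge0 ?(ltW t0)// expRD mulrC ler_wpM2r ?expR_ge0//.
  rewrite ler_pdivlMr// mulrDr mulr1 -expRM_natl -expRD.
  apply: lerD; first by rewrite expR_le1 oppr_le0 ltW.
  by have := hK t t0; rewrite addrC mulrA.
- exact: integrableZl.
Qed.

Lemma integrable_gamma_Re a b : 0 < a ->
  mu.-integrable halfline (EFin \o gamma_Re (a - 1) b).
Proof.
move=> a0; apply: (le_integrable _ _ _ (integrable_expR_ln a0)); first by [].
  apply/measurable_EFinP; apply: measurable_halfline => t; exact: continuous_gamma_Re.
move=> t _; rewrite /= lee_fin /gamma_Re normrM.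
by rewrite -[leRHS]mulr1 ler_wpM2l// cos_max.
Qed.

Lemma integrable_gamma_Im a b : 0 < a ->
  mu.-integrable halfline (EFin \o gamma_Im (a - 1) b).
Proof.
move=> a0; apply: (le_integrable _ _ _ (integrable_expR_ln a0)); first by [].
  apply/measurable_EFinP; apply: measurable_halfline => t; exact: continuous_gamma_Im.
move=> t _; rewrite /= lee_fin /gamma_Im normrM.
by rewrite -[leRHS]mulr1 ler_wpM2l// sin_max.
Qed.

(** Boundedness of t^(a+1) e^(-t) leaves a spare factor 1/t. *)
Lemma cvg_expR_ln_infty a : 0 < a ->
  expR (a * ln m.+2%:R - m.+2%:R) @[m --> \oo] --> 0.
Proof.
move=> a0; have [K K0 hK] := @expR_ln_bounded (a + 1) (addr_ge0 (ltW a0) ler01).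
apply/cvgrPdist_lt => e e0; near=> m.
have m0 : 0 < m.+2%:R :> R by [].
rewrite sub0r normrN ger0_norm ?expR_ge0//.
have -> : a = a + 1 - 1 by rewrite addrK.
rewrite expR_ln_pred// ltr_pdivrMr// (le_lt_trans (hK _ m0))//.
rewrite mulrC -ltr_pdivrMr//.
rewrite (@lt_le_trans _ _ m%:R)// ?ler_nat; last by rewrite -addn2 leq_addr.
by near: m; exact: nbhs_infty_gtr.
Unshelve. all: by end_near. Qed.

Lemma cvg_expR_ln_0 a : 0 < a ->
  expR (a * ln m.+2%:R^-1 - m.+2%:R^-1) @[m --> \oo] --> 0.
Proof.
move=> a0; apply/cvgrPdist_lt => e e0; near=> m.
rewrite sub0r normrN ger0_norm ?expR_ge0//.
rewrite lnV ?posrE// mulrN -mulNr.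
apply: (@le_lt_trans _ _ (expR (- a * ln m.+2%:R))).
  by rewrite ler_expR gerBl invr_ge0.
near: m; have [N _ hN] := near_expR_Nln a0 e0.
by exists N => // m /= Nm; apply: hN; rewrite /= (leq_trans Nm)// -addn2 leq_addr.
Unshelve. all: by end_near. Qed.

End GammaIntegrand.

(** * Functional equation of Gamma and its values at integers *)

Section GammaFunction.
Variable R : realType.
Local Notation mu := (@lebesgue_measure R).
Local Notation halfline := (`]0%R, +oo[%classic : set R).
Local Notation normc := (@Normc.normc R).
Local Notation Re := (@complex.Re R).
Local Notation Im := (@complex.Im R).
Local Opaque expC.
Implicit Types (f g : R -> R) (a b c v w t : R) (s : R[i]).

(** Bundling integrability with the value lets linearity and comparison be chained without separate
    integrability conditions. *)
Definition has_int f v : Prop :=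
  mu.-integrable halfline (EFin \o f) /\ \int[mu]_(t in `]0, +oo[) f t = v.

Lemma has_intD f g v w : has_int f v -> has_int g w ->
  has_int (fun t => f t + g t) (v + w).
Proof.
move=> [fi <-] [gi <-]; split.
  by refine (integrableD _ fi gi).
by rewrite RintegralD.
Qed.

Lemma has_intZ f v c : has_int f v -> has_int (fun t => c * f t) (c * v).
Proof.
move=> [fi <-]; split.
  by refine (integrableZl _ c fi).
by rewrite RintegralZl.
Qed.

Lemma has_int_ext f g v : (forall t, 0 < t -> f t = g t) ->
  has_int f v -> has_int g v.
Proof.
move=> fg [fi <-].
have fgD : {in halfline, f =1 g}.
  by move=> t; rewrite inE /= in_itv /= andbT => /fg.
split; last exact/esym/eq_Rintegral.
by apply: eq_integrable fi => // t tD /=; rewrite fgD.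
Qed.

Lemma has_int_le f g v w : (forall t, 0 < t -> f t <= g t) ->
  has_int f v -> has_int g w -> v <= w.
Proof.
move=> fg [fi <-] [gi <-]; apply: le_Rintegral => // t.
by rewrite /= in_itv /= andbT => /fg.
Qed.

Lemma has_int_norm_le f g v w : (forall t, 0 < t -> `|f t| <= g t) ->
  has_int f v -> has_int g w -> `|v| <= w.
Proof.
move=> fg fv gw; rewrite ler_norml; apply/andP; split.
  rewrite -mulN1r; apply: has_int_le (has_intZ (-1) gw) fv => t /fg.
  by rewrite ler_norml mulN1r => /andP[].
by apply: has_int_le fv gw => t /fg; rewrite ler_norml => /andP[].
Qed.

Lemma has_int_derive f (F : R -> R) v (l1 l0 : R) : has_int f v ->
  (forall t, 0 < t -> {for t, continuous f}) ->
  (forall t, 0 < t -> is_derive t 1 F (f t)) ->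
  F m.+2%:R @[m --> \oo] --> l1 -> F m.+2%:R^-1 @[m --> \oo] --> l0 ->
  v = l1 - l0.
Proof. move=> [fi <-] cf dF F1 F0; exact: (Rintegral_derive cf dF fi F1 F0). Qed.

Lemma gammaCE s : gammaC s =
  (\int[mu]_(t in `]0, +oo[) gamma_Re (Re s - 1) (Im s) t) +i*
  (\int[mu]_(t in `]0, +oo[) gamma_Im (Re s - 1) (Im s) t).
Proof.
have ReE t : Re ((s - 1) * (ln t)%:C - t%:C) = (Re s - 1) * ln t - t.
  by case: s => x y /=; ring.
have ImE t : Im ((s - 1) * (ln t)%:C - t%:C) = Im s * ln t.
  by clear ReE; case: s => x y /=; ring.
rewrite /gammaC /integralC; congr (_ +i* _); apply: eq_Rintegral => t _.
  by rewrite Re_expC ReE ImE.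
by rewrite Im_expC ReE ImE.
Qed.

Lemma has_int_gamma_Re s : 0 < Re s ->
  has_int (gamma_Re (Re s - 1) (Im s)) (Re (gammaC s)).
Proof.
by move=> s0; split; [exact: integrable_gamma_Re|rewrite gammaCE].
Qed.

Lemma has_int_gamma_Im s : 0 < Re s ->
  has_int (gamma_Im (Re s - 1) (Im s)) (Im (gammaC s)).
Proof.
by move=> s0; split; [exact: integrable_gamma_Im|rewrite gammaCE].
Qed.

Lemma cvg0_bounded (u v : nat -> R) : (forall m, `|u m| <= v m) ->
  v m @[m --> \oo] --> 0 -> u m @[m --> \oo] --> 0.
Proof.
move=> uv v0; apply: norm_cvg0; apply: (squeeze_cvgr _ (cvg_cst 0) v0).
by apply: nearW => m; rewrite normr_ge0 uv.
Qed.

Lemma gamma_Re_bound a b t : `|gamma_Re a b t| <= expR (a * ln t - t).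
Proof.
rewrite /gamma_Re normrM ger0_norm ?expR_ge0//.
by rewrite -[leRHS]mulr1 ler_wpM2l ?expR_ge0// cos_max.
Qed.

Lemma gamma_Im_bound a b t : `|gamma_Im a b t| <= expR (a * ln t - t).
Proof.
rewrite /gamma_Im normrM ger0_norm ?expR_ge0//.
by rewrite -[leRHS]mulr1 ler_wpM2l ?expR_ge0// sin_max.
Qed.

(** Integration by parts: the derivative of t^s e^(-t) is integrated, separately in real and
    imaginary part. Both boundary terms vanish because Re s > 0, whence the 0 - 0. *)
Lemma gammaCS s : 0 < Re s -> gammaC (s + 1) = s * gammaC s.
Proof.
move=> s0.
have s10 : 0 < Re (s + 1) by rewrite ReD /= addr_gt0.
have ReS : Re (s + 1) - 1 = Re s by rewrite ReD /= addrK.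
have ImS : Im (s + 1) = Im s by rewrite ImD /= addr0.
have r0 := has_int_gamma_Re s0; have i0 := has_int_gamma_Im s0.
have r1 := has_int_gamma_Re s10; have i1 := has_int_gamma_Im s10.
rewrite ReS ImS in r1 i1.
have cRe := @continuous_gamma_Re R; have cIm := @continuous_gamma_Im R.
apply/eqP; rewrite eq_complex; apply/andP; split; apply/eqP.
  rewrite [RHS]ReM.
  have E : Re s * Re (gammaC s) + -1 * Re (gammaC (s + 1)) +
      - Im s * Im (gammaC s) = 0 - 0.
    apply: (has_int_derive (F := gamma_Re (Re s) (Im s)) (has_intD (has_intD
      (has_intZ (Re s) r0) (has_intZ (-1) r1)) (has_intZ (- Im s) i0))).
    - move=> t t0; apply: cvgD; first apply: cvgD.
      + by apply: cvgM; [exact: cvg_cst|exact: cRe].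
      + by apply: cvgM; [exact: cvg_cst|exact: cRe].
      + by apply: cvgM; [exact: cvg_cst|exact: cIm].
    - move=> t t0; apply: is_derive_eq (is_derive_gamma_Re _ _ t0) _; ring.
    - exact: cvg0_bounded (fun m => gamma_Re_bound _ _ _) (cvg_expR_ln_infty s0).
    - exact: cvg0_bounded (fun m => gamma_Re_bound _ _ _) (cvg_expR_ln_0 s0).
  by lra.
rewrite [RHS]ImM.
have E : Re s * Im (gammaC s) + -1 * Im (gammaC (s + 1)) +
    Im s * Re (gammaC s) = 0 - 0.
  apply: (has_int_derive (F := gamma_Im (Re s) (Im s)) (has_intD (has_intD
    (has_intZ (Re s) i0) (has_intZ (-1) i1)) (has_intZ (Im s) r0))).
  - move=> t t0; apply: cvgD; first apply: cvgD.
    + by apply: cvgM; [exact: cvg_cst|exact: cIm].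
    + by apply: cvgM; [exact: cvg_cst|exact: cIm].
    + by apply: cvgM; [exact: cvg_cst|exact: cRe].
  - move=> t t0; apply: is_derive_eq (is_derive_gamma_Im _ _ t0) _; ring.
  - exact: cvg0_bounded (fun m => gamma_Im_bound _ _ _) (cvg_expR_ln_infty s0).
  - exact: cvg0_bounded (fun m => gamma_Im_bound _ _ _) (cvg_expR_ln_0 s0).
by lra.
Qed.

Lemma gammaC_addn s n : 0 < Re s -> gammaC (s + n%:R) = rising s n * gammaC s.
Proof.
move=> s0; rewrite /rising; elim: n => [|n IHn].
  by rewrite addr0 big_ord0 mul1r.
rewrite big_ord_recr /= mulrAC -IHn -natr1 addrA gammaCS 1?[RHS]mulrC//.
have -> : (n%:R : R[i]) = (n%:R : R)%:C by rewrite rmorph_nat.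
by rewrite ReD /= ltr_wpDr.
Qed.

Lemma has_int_expRN : has_int (fun t => expR (- t)) 1.
Proof.
have i1 := @integrable_expR_ln R 1 ltr01.
rewrite (_ : (fun t => expR _) = (fun t => expR (- t))) in i1; last first.
  by apply/funext => t; rewrite subrr mul0r sub0r.
have dE t : is_derive t 1 (fun t => - expR (- t)) (expR (- t)).
  have h : is_derive t 1 (fun t => - t) (-1) by exact: is_deriveNid.
  apply: is_derive_eq (is_deriveN (is_derive1_comp (is_derive_expR _) h)) _.
  by rewrite mulrN1 opprK.
have cE t : {for t, continuous (fun t => expR (- t))}.
  have h : is_derive t 1 (fun t => - t) (-1) by exact: is_deriveNid.
  exact: is_derive_continuous (is_derive1_comp (is_derive_expR _) h).
split => //; rewrite -[RHS]opprK -[RHS]add0r.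
apply: (@Rintegral_derive _ _ (fun t => - expR (- t))) => //.
  apply: (@cvg0_bounded _ (fun m => m.+2%:R^-1)) => [m|].
    rewrite normrN ger0_norm ?expR_ge0// expRN lef_pV2 ?posrE ?expR_gt0//.
    by have := expR_ge1Dx (m.+2%:R : R); lra.
  apply: (@cvg0_bounded _ harmonic); last exact: cvg_harmonic.
  by move=> m; rewrite ger0_norm ?invr_ge0//= lef_pV2 ?posrE// ler_nat.
have -> : (-1 : R) = - expR (- 0) by rewrite oppr0 expR0.
apply: cvgN.
have c0 := @continuous_expR R (- 0).
suff h : (- m.+2%:R^-1 : R) @[m --> \oo] --> (- 0 : R) by exact: (cvg_comp _ _ h c0).
apply: cvgN; apply: (@cvg0_bounded _ harmonic); last exact: cvg_harmonic.
by move=> m; rewrite ger0_norm ?invr_ge0//= lef_pV2 ?posrE// ler_nat.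
Qed.

(** Gamma(m + 1) = m!, from Gamma(1) = 1 and the functional equation. These integrals provide all
    moments of the Gamma distribution used below. *)
Lemma has_int_fact (m : nat) :
  has_int (fun t => expR (m%:R * ln t - t)) m`!%:R.
Proof.
have g1 : gammaC (1 : R[i]) = 1.
  rewrite gammaCE; apply/eqP; rewrite eq_complex /= subrr; apply/andP; split.
    rewrite -has_int_expRN.2; apply/eqP; apply: eq_Rintegral => t _.
    by rewrite /gamma_Re !mul0r cos0 mulr1 sub0r.
  have -> : gamma_Im 0 0 = cst (0 : R).
    by apply/funext => t; rewrite /gamma_Im !mul0r sin0 mulr0.
  by rewrite /Rintegral integral0.
have gE : gammaC (1 + m%:R : R[i]) = m`!%:R.
  rewrite gammaC_addn//= g1 mulr1 /rising.
  elim: m => [|m IHm]; first by rewrite big_ord0.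
  by rewrite big_ord_recr /= IHm factS natrM mulrC nat1r.
have mE : (m%:R : R[i]) = (m%:R : R)%:C by rewrite rmorph_nat.
have := @has_int_gamma_Re (1 + m%:R).
rewrite gE !mE ReD ImD /= addr0 addrC addrK ltr_wpDl// => /(_ isT).
rewrite -(rmorph_nat (real_complex R) m`!) /=; apply: has_int_ext => t t0.
by rewrite /gamma_Re mul0r cos0 mulr1.
Qed.

End GammaFunction.

(** * Comparison of Gamma(s + n) with (n - 1)! n^s *)

Section GammaAsymptotics.
Variable R : realType.
Local Notation normc := (@Normc.normc R).
Local Notation Re := (@complex.Re R).
Local Notation Im := (@complex.Im R).
Local Opaque expC.
Implicit Types (s : R[i]) (t : R) (p j M : nat).

(* The [j]-th moment of [G / n], where [G] is Gamma distributed with shape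
   parameter [n = p + 1]. *)
Definition gmoment p j : R := (p + j)`!%:R / (p`!%:R * p.+1%:R ^+ j).

Lemma gmoment0 p : gmoment p 0 = 1.
Proof. by rewrite /gmoment addn0 expr0 mulr1 divff// pnatr_eq0 -lt0n fact_gt0. Qed.

Lemma gmomentS p j : gmoment p j.+1 = gmoment p j * (1 + j%:R / p.+1%:R).
Proof.
rewrite /gmoment addnS factS natrM exprS -addSn natrD.
have : p.+1%:R != 0 :> R by rewrite pnatr_eq0.
have : p`!%:R != 0 :> R by rewrite pnatr_eq0 -lt0n fact_gt0.
move: p.+1%:R p`!%:R (p + j)`!%:R => n f q f0 n0.
have : n ^+ j != 0 by rewrite expf_neq0.
by move: (n ^+ j) => nj nj0; field; rewrite f0 n0 nj0.
Qed.

Lemma gmoment_ge0 p j : 0 <= gmoment p j.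
Proof. by rewrite divr_ge0// mulr_ge0// exprn_ge0. Qed.

(** Each factor 1 + i/n of the moment is at most 1 + i, so the bound is uniform in [p]. *)
Lemma gmoment_le p j : gmoment p j <= j`!%:R.
Proof.
elim: j => [|j IHj]; first by rewrite gmoment0.
rewrite gmomentS factS mulnC natrM.
apply: ler_pM => //; first exact: gmoment_ge0.
rewrite -(nat1r j) lerD2l ler_pdivrMr//.
by rewrite -[leLHS]mulr1 ler_wpM2l// ler1n.
Qed.

(** Unnormalised density of [G] with shape n = p + 1; its total mass is p!. *)
Definition gweight p t := expR (p%:R * ln t - t).

Lemma has_int_gweight p j :
  has_int (fun t => gweight p t * (t / p.+1%:R) ^+ j) (p`!%:R * gmoment p j).
Proof.
have h := has_intZ (p.+1%:R ^- j) (has_int_fact R (p + j)).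
have -> : p`!%:R * gmoment p j = p.+1%:R ^- j * (p + j)`!%:R.
  rewrite /gmoment.
  have : p.+1%:R ^+ j != 0 :> R by rewrite expf_neq0// pnatr_eq0.
  have : p`!%:R != 0 :> R by rewrite pnatr_eq0 -lt0n fact_gt0.
  by move: (p.+1%:R ^+ j) p`!%:R => nj f f0 nj0; field; rewrite f0 nj0.
apply: has_int_ext h => t t0.
rewrite /gweight natrD mulrDl -addrA [_ - t]addrC addrA expRD expR_natln//.
by rewrite expr_div_n mulrC -mulrA.
Qed.

(** In the expanded square the constant terms cancel: (1 + j/n)(1 + (j+1)/n) - 2 (1 + j/n) + 1 = 1/n
    + j(j+1)/n^2. The factor 1/n is the source of the rate; j = 0 is the variance. *)
Lemma has_int_gweight_sqr p j :
  has_int (fun t => gweight p t * (t / p.+1%:R) ^+ j * (t / p.+1%:R - 1) ^+ 2)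
    (p`!%:R * (gmoment p j * (p.+1%:R^-1 * (1 + (j * j.+1)%:R / p.+1%:R)))).
Proof.
have h := has_intD (has_intD (has_int_gweight p j.+2)
  (has_intZ (-2) (has_int_gweight p j.+1))) (has_int_gweight p j).
have -> : p`!%:R * (gmoment p j * (p.+1%:R^-1 * (1 + (j * j.+1)%:R / p.+1%:R))) =
   p`!%:R * gmoment p j.+2 + -2 * (p`!%:R * gmoment p j.+1) + p`!%:R * gmoment p j.
  have : p.+1%:R != 0 :> R by rewrite pnatr_eq0.
  rewrite !gmomentS natrM -(nat1r j); move: p.+1%:R => n n0.
  by field.
apply: has_int_ext h => t t0; rewrite !exprS expr0; ring.
Qed.

Definition gconst M : R := (12 * M%:R + 4) * (1 + M`!%:R * (1 + (M * M.+1)%:R)).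

(* With [d = n ^ (- 1/2)], AM-GM gives [|x - 1| <= (d + (x - 1)^2 / d) / 2]. *)
Lemma gweight_int_le M p (f : R -> R) (v c : R) :
  0 <= c ->
  (forall t, 0 < t -> `|f t| <= c * (gweight p t *
    (`|t / p.+1%:R - 1| * (1 + (t / p.+1%:R) ^+ M)))) ->
  has_int f v ->
  `|v| <= c * (p`!%:R * (expR (- 2^-1 * ln p.+1%:R) *
    (1 + M`!%:R * (1 + (M * M.+1)%:R)))).
Proof.
move=> c0 hf fv; set d := expR _.
have d0 : 0 < d by exact: expR_gt0.
have n0 : 0 < p.+1%:R :> R by [].
have dd : d * d = p.+1%:R^-1.
  by rewrite /d -expRD -{3}(lnK n0) -expRN; congr expR; field.
(* The factor 1 + x^M makes the orders 0 and [M] appear together. *)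
have h := has_intZ (c * 2^-1) (has_intD
  (has_intZ d (has_intD (has_int_gweight p 0) (has_int_gweight p M)))
  (has_intZ d^-1 (has_intD (has_int_gweight_sqr p 0) (has_int_gweight_sqr p M)))).
apply: le_trans (has_int_norm_le _ fv h) _.
  move=> t t0; apply: le_trans (hf t t0) _.
  rewrite -mulrA ler_wpM2l//; set x := t / p.+1%:R.
  have x0 : 0 < x by rewrite divr_gt0.
  have w0 : 0 < gweight p t by exact: expR_gt0.
  have xM : 0 < x ^+ M by rewrite exprn_gt0.
  have AG : `|x - 1| <= 2^-1 * (d + d^-1 * (x - 1) ^+ 2).
    have : 0 <= d^-1 * (`|x - 1| - d) ^+ 2.
      by rewrite mulr_ge0 ?invr_ge0 ?sqr_ge0// ltW.
    rewrite sqrrB real_normK ?num_real// => h0.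
    have E : d^-1 * d = 1 by rewrite mulVf// gt_eqF.
    have : d^-1 * ((x - 1) ^+ 2 - `|x - 1| * d *+ 2 + d ^+ 2) =
      d^-1 * (x - 1) ^+ 2 - `|x - 1| * 2 * (d^-1 * d) + d * (d^-1 * d) by ring.
    rewrite E => E2; rewrite E2 in h0; lra.
  have W : 0 < gweight p t * (1 + x ^+ M) by rewrite mulr_gt0// addr_gt0.
  have H := ler_wpM2r (ltW W) AG.
  rewrite [leLHS](_ : _ = `|x - 1| * (gweight p t * (1 + x ^+ M))); last by ring.
  apply: (le_trans H); rewrite le_eqVlt; apply/orP; left; apply/eqP.
  by rewrite expr0; move: (x ^+ M) => y; ring.
rewrite gmoment0 !mul1r -mulrA ler_wpM2l//.
have gM := gmoment_le p M; have gM0 := gmoment_ge0 p M.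
set P : R := p`!%:R; set g := gmoment p M in gM gM0 *.
have P0 : 0 <= P by [].
set q := (M * M.+1)%:R : R.
have q0 : 0 <= q by [].
rewrite mul0n mul0r addr0 mulr1.
have n1 : p.+1%:R^-1 <= 1 :> R by rewrite invf_le1// ler1n.
have qn : q / p.+1%:R <= q by rewrite -[leRHS]mulr1 ler_wpM2l.
(* Since d^2 = 1/n, the product of [d^-1] with the 1/n of the second moments is again [d]: this
   choice of [d] balances the two halves. *)
rewrite [leLHS](_ : _ =
    P * (d * (2^-1 * (1 + g + (1 + g * (1 + q / p.+1%:R)))))); last first.
  by rewrite -dd; field; rewrite gt_eqF.
rewrite ler_wpM2l// ler_wpM2l ?(ltW d0)//.
have h1 : g * (1 + q / p.+1%:R) <= M`!%:R * (1 + q).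
  by rewrite ler_pM ?addr_ge0 ?divr_ge0 ?lerD2l.
have h2 : M`!%:R <= M`!%:R * (1 + q) by rewrite ler_peMr// lerDl.
move: h1 h2 gM; move: (g * _) (_ * (1 + q)) => A B; lra.
Qed.

(** The integrand of Gamma(s + n) is [gweight p t] times t^s, and n^s p! is the integral of
    [gweight p t] times n^s. The difference t^s - n^s = n^s ((t/n)^s - 1) is bounded by
    [normc_cpow_sub1_le]; treating real and imaginary parts separately costs the factor 2. *)
Lemma normc_gammaC_addn_sub M p s : 0 < Re s -> normc s <= M%:R ->
  normc (gammaC (s + p.+1%:R) - expC (s * (ln p.+1%:R)%:C) * p`!%:R) <=
  2 * gconst M * (p`!%:R * expR (Re s * ln p.+1%:R) *
    expR (- 2^-1 * ln p.+1%:R)).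
Proof.
move=> s0 sM; set n : R := p.+1%:R; set ns := expC _.
have n0 : 0 < n by [].
have nE : (p.+1%:R : R[i]) = n%:C by rewrite rmorph_nat.
have fE : (p`!%:R : R[i]) = (p`!%:R : R)%:C by rewrite rmorph_nat.
have sn0 : 0 < Re (s + p.+1%:R) by rewrite nE ReD /= addr_gt0.
have hR := has_int_gamma_Re sn0; have hI := has_int_gamma_Im sn0.
have ReSn : Re (s + p.+1%:R) = Re s + n by rewrite nE ReD.
have ImSn : Im (s + p.+1%:R) = Im s by rewrite nE ImD /= addr0.
rewrite ReSn ImSn in hR hI.
have wE t : 0 < t ->
   expR ((Re s + n - 1) * ln t - t) = gweight p t * expR (Re s * ln t).
  by move=> t0; rewrite /gweight -expRD /n -natr1; congr expR; ring.
have ReE t : Re (s * (ln t)%:C) = Re s * ln t.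
  by rewrite mulrC ReM_real mulrC.
have ImE t : Im (s * (ln t)%:C) = Im s * ln t.
  by rewrite mulrC ImM_real mulrC.
have nsE : normc ns = expR (Re s * ln n) by rewrite normc_expC ReE.
have bound t : 0 < t -> normc (expC (s * (ln t)%:C) - ns) <=
    expR (Re s * ln n) * (12 * M%:R + 4) * (`|t / n - 1| * (1 + (t / n) ^+ M)).
  move=> t0; have tn : 0 < t / n by rewrite divr_gt0.
  have -> : expC (s * (ln t)%:C) - ns = ns * (expC (s * (ln (t / n))%:C) - 1).
    have {1}-> : ln t = ln n + ln (t / n).
      by rewrite lnM ?posrE ?invr_gt0// lnV ?posrE//; ring.
    by rewrite rmorphD /= mulrDr expCD mulrBr mulr1.
  rewrite Normc.normcM nsE -mulrA ler_wpM2l ?expR_ge0//.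
  by apply: normc_cpow_sub1_le => //; exact: ltW.
have c0 : 0 <= expR (Re s * ln n) * (12 * M%:R + 4).
  by rewrite mulr_ge0 ?expR_ge0// addr_ge0// mulr_ge0.
have w0 t : 0 <= gweight p t by exact: expR_ge0.
have hw := has_int_fact R p.
have hRe := has_intD hR (has_intZ (- Re ns) hw).
have hIm := has_intD hI (has_intZ (- Im ns) hw).
have bRe := gweight_int_le (M := M) (p := p) c0 _ hRe.
have bIm := gweight_int_le (M := M) (p := p) c0 _ hIm.
apply: (le_trans (normc_le_ReIm _)).
rewrite ReD ImD ReN ImN [Re (ns * _)]ReM [Im (ns * _)]ImM fE /=.
rewrite !mulr0 subr0 add0r -!mulNr.
rewrite /gconst.
set K := 1 + _ in bRe bIm *.
have -> : 2 * ((12 * M%:R + 4) * K) *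
    (p`!%:R * expR (Re s * ln n) * expR (- 2^-1 * ln n)) =
   (expR (Re s * ln n) * (12 * M%:R + 4)) * (p`!%:R * (expR (- 2^-1 * ln n) * K)) +
   (expR (Re s * ln n) * (12 * M%:R + 4)) * (p`!%:R * (expR (- 2^-1 * ln n) * K)) by ring.
apply: lerD; [apply: bRe|apply: bIm] => t t0.
  have -> : gamma_Re (Re s + n - 1) (Im s) t + - Re ns * expR (p%:R * ln t - t) =
     gweight p t * Re (expC (s * (ln t)%:C) - ns).
    by rewrite /gamma_Re wE// ReD ReN Re_expC ReE ImE -/(gweight p t); ring.
  rewrite normrM (ger0_norm (w0 t)) mulrCA ler_wpM2l//.
  by apply: le_trans (bound t t0); exact: normc_Re_le.
have -> : gamma_Im (Re s + n - 1) (Im s) t + - Im ns * expR (p%:R * ln t - t) =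
   gweight p t * Im (expC (s * (ln t)%:C) - ns).
  by rewrite /gamma_Im wE// ImD ImN Im_expC ReE ImE -/(gweight p t); ring.
rewrite normrM (ger0_norm (w0 t)) mulrCA ler_wpM2l//.
by apply: le_trans (bound t t0); exact: normc_Im_le.
Qed.

End GammaAsymptotics.

(** * Asymptotics of the alternating sum *)

Section LahSum.
Variable R : realType.
Local Notation normc := (@Normc.normc R).
Local Notation Re := (@complex.Re R).
Local Notation Im := (@complex.Im R).
Local Opaque expC.
Implicit Types (s u : R[i]) (t : R) (p j n k M : nat).

(** Written without Gamma, so that it keeps a meaning at s = 0. *)
Definition gamma_ratio n s : R[i] :=
  rising s n / (n.-1`!%:R * expC (s * (ln n%:R)%:C)).

Lemma normc_natr n : normc n%:R = n%:R.
Proof. by rewrite -(rmorph_nat (real_complex R)) normc_real ger0_norm. Qed.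

Lemma normc_prod n (F : 'I_n -> R[i]) :
  normc (\prod_(i < n) F i) = \prod_(i < n) normc (F i).
Proof. exact: (big_morph _ (@Normc.normcM R) (@Normc.normc1 R)). Qed.

Lemma normc_sum_le n (F : 'I_n -> R[i]) :
  normc (\sum_(i < n) F i) <= \sum_(i < n) normc (F i).
Proof.
elim/big_rec2: _ => [|i y z _ h]; first by rewrite Normc.normc0.
by apply: le_trans (le_normcD _ _) _; rewrite lerD2l.
Qed.

Lemma normc_rising_le M n s : normc s <= M%:R ->
  normc (rising s n) <= (M + n)%:R ^+ n.
Proof.
move=> sM; rewrite normc_prod.
apply: (@le_trans _ _ (\prod_(i < n) (M + n)%:R)); last first.
  by rewrite prodr_const card_ord.
apply: ler_prod => i _; rewrite normc_ge0 /=.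
apply: le_trans (le_normcD _ _) _; rewrite normc_natr natrD lerD// ler_nat.
exact: ltnW.
Qed.

Lemma Re_mulln s t : Re (s * (ln t)%:C) = Re s * ln t.
Proof. by rewrite mulrC ReM_real mulrC. Qed.

Lemma ln_nat_ge0 n : (0 < n)%N -> 0 <= ln n%:R :> R.
Proof. by move=> n0; rewrite ln_ge0// ler1n. Qed.

Lemma gconst_ge0 M : 0 <= gconst R M.
Proof. by rewrite /gconst mulr_ge0// addr_ge0// mulr_ge0. Qed.

Lemma gamma_ratio_mul M n s : (0 < n)%N -> 0 < Re s -> normc s <= M%:R ->
  normc (gamma_ratio n s * gammaC s - 1) <=
    2 * gconst R M * expR (- 2^-1 * ln n%:R).
Proof.
case: n => // p _ s0 sM; have h := normc_gammaC_addn_sub p s0 sM.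
rewrite /gamma_ratio /=.
set ns := expC _ in h *.
have nsn : normc ns = expR (Re s * ln p.+1%:R) by rewrite normc_expC Re_mulln.
have f0 : 0 < p`!%:R :> R by rewrite ltr0n fact_gt0.
have f0' : p`!%:R != 0 :> R[i] by rewrite pnatr_eq0 -lt0n fact_gt0.
have ns0 : ns != 0 by exact: expC_neq0.
have -> : rising s p.+1 / (p`!%:R * ns) * gammaC s - 1 =
    (gammaC (s + p.+1%:R) - ns * p`!%:R) / (p`!%:R * ns).
  rewrite gammaC_addn//; move: (rising _ _) (gammaC s) => A B.
  by field; rewrite f0' ns0.
rewrite Normc.normcM Normc.normcV Normc.normcM normc_natr nsn.
rewrite ler_pdivrMr ?mulr_gt0 ?expR_gt0//; apply: le_trans h _.
by rewrite le_eqVlt; apply/orP; left; apply/eqP; ring.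
Qed.

(** The index [n0] depends on [M] alone. There |[gamma_ratio n0 s] Gamma(s)| >= 1/2 and
    |[gamma_ratio n0 s]| <= B, hence |1 / Gamma(s)| <= 2 B; multiplying the estimate of
    [gamma_ratio_mul] by 1 / Gamma(s) then gives the rate. *)
Lemma gamma_ratio_cvg M : exists2 C : R, 0 < C &
  forall n s, (0 < n)%N -> 0 < Re s -> normc s <= M%:R ->
  [/\ gammaC s != 0, normc (gammaC s)^-1 <= C, normc (gamma_ratio n s) <= C &
      normc (gamma_ratio n s - (gammaC s)^-1) <= C * expR (- 2^-1 * ln n%:R)].
Proof.
set C0 := 2 * gconst R M; have C00 : 0 <= C0 by rewrite mulr_ge0 ?gconst_ge0.
have [n0 n00 hn0] : exists2 n0, (0 < n0)%N & C0 * expR (- 2^-1 * ln n0%:R) <= 2^-1.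
  have e0 : 0 < 2^-1 / (C0 + 1) :> R by rewrite divr_gt0// ltr_wpDl.
  have h2 : 0 < 2^-1 :> R by rewrite invr_gt0.
  have [N _ hN] := near_expR_Nln h2 e0.
  exists N.+1 => //; have := ltW (hN N.+1 (leqnSn N)).
  set E := expR _; rewrite ler_pdivlMr ?ltr_wpDl// => h.
  have E0 : 0 <= E by exact: expR_ge0.
  by lra.
set B : R := (M + n0)%:R ^+ n0.
have B0 : 0 <= B by rewrite exprn_ge0.
have key s : 0 < Re s -> normc s <= M%:R ->
    gammaC s != 0 /\ normc (gammaC s)^-1 <= 2 * B.
  move=> s0 sM; have h := gamma_ratio_mul n00 s0 sM.
  have {h} h : normc (gamma_ratio n0 s * gammaC s - 1) <= 2^-1 by exact: le_trans hn0.
  have h1 : 1 <= normc (gamma_ratio n0 s * gammaC s) + 2^-1.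
    have := normcB_le (gamma_ratio n0 s * gammaC s) (gamma_ratio n0 s * gammaC s - 1).
    by rewrite opprB addrC subrK Normc.normc1; lra.
  have rB : normc (gamma_ratio n0 s) <= B.
    (* The denominator (n0 - 1)! n0^s has modulus at least 1, so bounding the rising factorial is
       enough. *)
    rewrite /gamma_ratio Normc.normcM Normc.normcV Normc.normcM normc_natr.
    rewrite normc_expC Re_mulln.
    apply: le_trans (normc_rising_le n0 sM).
    rewrite -[leRHS]mulr1 ler_wpM2l ?normc_ge0// invf_le1; last first.
      by rewrite mulr_gt0 ?expR_gt0// ltr0n fact_gt0.
    rewrite mulr_ege1// ?ler1n ?fact_gt0//.
    by rewrite leNgt expR_lt1 -leNgt mulr_ge0 ?(ltW s0)// ln_nat_ge0.
  have g0 : gammaC s != 0.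
    apply/eqP => g0; move: h1; rewrite g0 mulr0 Normc.normc0; lra.
  split => //; rewrite Normc.normcV.
  have gp : 0 < normc (gammaC s) by rewrite lt_neqAle normc_ge0 eq_sym normc_eq0 g0.
  rewrite -[leLHS]mul1r ler_pdivrMr//.
  rewrite Normc.normcM in h1.
  have : normc (gamma_ratio n0 s) * normc (gammaC s) <= B * normc (gammaC s).
    by rewrite ler_wpM2r// ltW.
  by lra.
exists (2 * B + 2 * B * C0 + 1) => [|n s n1 s0 sM].
  by rewrite ltr_wpDl// addr_ge0 ?mulr_ge0.
have [g0 gB] := key s s0 sM.
have h := gamma_ratio_mul n1 s0 sM.
set E := expR _ in h *.
have E0 : 0 <= E by exact: expR_ge0.
have E1 : E <= 1 by rewrite /E expR_le1 mulNr oppr_le0 mulr_ge0// ln_nat_ge0.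
have h2 : normc (gamma_ratio n s - (gammaC s)^-1) <= 2 * B * C0 * E.
  have -> : gamma_ratio n s - (gammaC s)^-1 =
      (gamma_ratio n s * gammaC s - 1) * (gammaC s)^-1.
    by move: (gamma_ratio n s) => A; field.
  by rewrite Normc.normcM -[leRHS]mulrA [leLHS]mulrC ler_pM ?normc_ge0.
have BC : 0 <= 2 * B * C0 by rewrite !mulr_ge0.
split => //.
- lra.
- rewrite -(subrK (gammaC s)^-1 (gamma_ratio n s)).
  apply: le_trans (le_normcD _ _) _.
  have : 2 * B * C0 * E <= 2 * B * C0 by rewrite -[leRHS]mulr1 ler_wpM2l.
  lra.
- apply: le_trans h2 _; rewrite ler_wpM2r//; lra.
Qed.

Definition lah_point (r : R) (i : nat) u : R[i] :=
  (i%:R + r)%:C * u + r%:C.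

(** The alternating sum divided by the growth (n - 1)! n^(s_k(u)) of its dominant term. *)
Definition lah_sum n (k : nat) (r : R) u : R[i] :=
  \sum_(i < k.+1) (-1) ^+ (k - i) * 'C(k, i)%:R * rising (lah_point r i u) n /
    (n.-1`!%:R * expC (lah_point r k u * (ln n%:R)%:C)).

Lemma rising0 n : (0 < n)%N -> rising (0 : R[i]) n = 0.
Proof. by case: n => // n _; rewrite /rising big_ord_recl /= addr0 mul0r. Qed.

(** The condition e <= 1/2 absorbs the error of the dominant term, and e <= d the factors n^(-(k-i)
    Re u) of the others. *)
Lemma lah_sum_cvg k (r : R) (B d e : R) : 0 <= r -> 0 < k%:R + r ->
  0 < d -> 0 <= e -> e <= d -> e <= 2^-1 ->
  exists2 C : R, 0 < C & forall n u, (0 < n)%N -> d <= Re u -> normc u <= B ->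
    [/\ gammaC (lah_point r k u) != 0,
        normc (gammaC (lah_point r k u))^-1 <= C &
        normc (lah_sum n k r u - (gammaC (lah_point r k u))^-1) <=
          C * expR (- e * ln n%:R)].
Proof.
move=> r0 kr0 d0 e0 ed e2.
(* [B'] bounds |s_i(u)| for all i <= k, so a single [M] serves every term. *)
set B' := (k%:R + r) * `|B| + r.
set M := (Num.trunc B').+1.
have BM : B' <= M%:R by rewrite ltW// truncnS_gt.
have [C C0 hC] := gamma_ratio_cvg M.
set S : R := \sum_(i < k) 'C(k, i)%:R.
have S0 : 0 <= S by rewrite sumr_ge0.
exists (C + S * C) => [|n u n0 du uB]; first by rewrite ltr_wpDr ?mulr_ge0// ltW.
have u0 : 0 < Re u by exact: lt_le_trans du.
have ReE i : Re (lah_point r i u) = (i%:R + r) * Re u + r.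
  by rewrite /lah_point ReD ReM_real.
have Rpos i : 0 < i%:R + r -> 0 < Re (lah_point r i u).
  by move=> h; rewrite ReE ltr_wpDr// mulr_gt0.
have nle i : (i <= k)%N -> normc (lah_point r i u) <= M%:R.
  move=> ik; apply: le_trans BM; apply: le_trans (le_normcD _ _) _.
  rewrite Normc.normcM !normc_real !ger0_norm ?addr_ge0// lerD2r.
  rewrite ler_pM ?addr_ge0 ?normc_ge0// ?lerD2r ?ler_nat//.
  exact: le_trans uB (ler_norm _).
have [g0 gC _ rC] := hC n _ n0 (Rpos k kr0) (nle k (leqnn k)).
split => //; first by rewrite (le_trans gC)// lerDl mulr_ge0// ltW.
have ln0 := ln_nat_ge0 n0.
rewrite /lah_sum big_ord_recr /= subnn expr0 binn !mul1r.
rewrite -/(gamma_ratio n (lah_point r k u)) -addrA.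
apply: le_trans (le_normcD _ _) _; rewrite [leLHS]addrC [leRHS]mulrDl; apply: lerD.
  apply: le_trans rC _; rewrite ler_wpM2l ?(ltW C0)// ler_expR !mulNr lerN2.
  by rewrite ler_wpM2r.
apply: le_trans (normc_sum_le _) _.
rewrite /S -mulrA mulr_suml; apply: ler_sum => i _.
have ik : (i < k)%N by [].
have -> : (-1) ^+ (k - i) * 'C(k, i)%:R * rising (lah_point r i u) n /
    (n.-1`!%:R * expC (lah_point r k u * (ln n%:R)%:C)) =
  (-1) ^+ (k - i) * ('C(k, i)%:R * (gamma_ratio n (lah_point r i u) *
     expC (((i%:R - k%:R)%:C * u) * (ln n%:R)%:C))).
  have -> : ((i%:R - k%:R)%:C * u) * (ln n%:R)%:C =
     lah_point r i u * (ln n%:R)%:C - lah_point r k u * (ln n%:R)%:C.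
    by rewrite /lah_point !rmorphD rmorphN /=; ring.
  rewrite expCB /gamma_ratio.
  have f0' : n.-1`!%:R != 0 :> R[i] by rewrite pnatr_eq0 -lt0n fact_gt0.
  move: (expC_neq0 (lah_point r i u * (ln n%:R)%:C)).
  move: (expC_neq0 (lah_point r k u * (ln n%:R)%:C)).
  move: (expC _) (expC (lah_point r i u * _)) f0' => a b.
  move: (rising _ _) ((-1) ^+ _) ('C(k, i)%:R) (n.-1`!%:R) => x y z f f0 a0 b0.
  by field; rewrite f0 a0 b0.
rewrite Normc.normcM normcX normcN Normc.normc1 expr1n mul1r.
rewrite Normc.normcM normc_natr ler_wpM2l//.
rewrite Normc.normcM normc_expC Re_mulln ReM_real.
have [ir|ir] := ltP 0 (i%:R + r).
  have [_ _ cC _] := hC n _ n0 (Rpos i ir) (nle i (ltnW ik)).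
  rewrite ler_pM ?normc_ge0 ?expR_ge0// ler_expR ler_wpM2r//.
  have : i.+1%:R <= k%:R :> R by rewrite ler_nat.
  rewrite -natr1 => ik1.
  have : (i%:R - k%:R) * Re u <= (-1) * Re u by rewrite ler_wpM2r ?(ltW u0)//; lra.
  lra.
(* Here s_i(u) = 0 lies outside the half plane, but for n >= 1 the rising factorial of 0 contains
   the factor 0. *)
have i0 : i = 0%N :> nat.
  apply/eqP; rewrite -(@pnatr_eq0 R) eq_le ler0n andbT; lra.
have rz : r = 0 by apply/eqP; rewrite eq_le r0 andbT; move: ir; rewrite i0 add0r.
have -> : lah_point r i u = 0.
  by rewrite /lah_point i0 rz mulr0n [0 + 0]addr0 rmorph0 mul0r addr0.
rewrite /gamma_ratio rising0// mul0r Normc.normc0 mul0r mulr_ge0 ?expR_ge0//.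
exact: ltW.
Qed.

End LahSum.

(** * The moment generating function *)

Section FiniteSupport.
Context (d : measure_display) (T : measurableType d) (R : realType).
Variables (P : probability T R) (X : {RV P >-> R}).

(** As the masses add up to 1, [X] avoids the points [x i] only on a null set; almost everywhere
    [h (X w)] is therefore a finite combination of indicators. *)
Lemma expectation_finite_support (N : nat) (x p : nat -> R) (h : R -> R) :
  injective x -> measurable_fun [set: R] h ->
  (forall i : 'I_N, P (X @^-1` [set x i]) = (p i)%:E) ->
  \sum_(i < N) p i = 1 ->
  ('E_P[fun w => h (X w)] = (\sum_(i < N) p i * h (x i))%:E)%E.
Proof.
move=> x_inj mh Px sp.
pose F i := X @^-1` [set x i].
have mF i : measurable (F i).
  rewrite -[F i]setTI; apply: measurable_funP => //.
pose U := \big[setU/set0]_(i < N) F i.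
have mU : measurable U by apply: bigsetU_measurable => i _; exact: mF.
have tF : trivIset setT F.
  by move=> i j _ _ [w [Xi Xj]]; apply: x_inj; rewrite -[LHS]Xi -[RHS]Xj.
have PU : P U = 1%E.
  rewrite measure_bigsetU// (eq_bigr (fun i : 'I_N => (p i)%:E)).
    by rewrite sumEFin sp.
  by move=> i _; exact: Px.
have PCU : P (~` U) = 0%E.
  by rewrite probability_setC// PU subee.
rewrite unlock.
pose g w : \bar R := (\sum_(i < N) (h (x i))%:E * (\1_(F i) w)%:E)%E.
have mg : measurable_fun setT g.
  apply: emeasurable_sum => i; apply: emeasurable_funM => //.
  by apply/measurable_EFinP; exact: measurable_indic.
have mhX : measurable_fun setT (fun w => (h (X w))%:E).
  by apply/measurable_EFinP; apply: measurableT_comp => //; exact: measurable_funP.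
rewrite (@ae_eq_integral _ _ _ P setT g)//; last first.
  exists (~` U); split => //; first exact: measurableC.
  move=> w /= hw Uw; apply: hw => _.
  move: Uw; rewrite /U -bigcup_mkord => -[i /= iN Xw].
  rewrite /g (bigD1 (Ordinal iN)) //= big1 ?adde0 => [|j ji].
    by rewrite indicE mem_set// mule1 Xw.
  rewrite indicE memNset ?mule0// => /= Xj.
  by move: ji => /eqP; apply; apply: val_inj => /=; apply: x_inj; rewrite -Xj Xw.
have iF i : P.-integrable setT (fun w => (\1_(F i) w)%:E) by exact: integrable_indic.
rewrite /g integral_sum//; last by move=> i; exact: integrableZl.
rewrite -sumEFin; apply: eq_bigr => i _.
rewrite integralZl// integral_indic// setIT.
by have /= -> := Px i; rewrite -EFinM mulrC.
Qed.

End FiniteSupport.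

Section LahMgf.
Variable R : realType.
Local Notation normc := (@Normc.normc R).
Local Notation Re := (@complex.Re R).
Local Notation Im := (@complex.Im R).
Implicit Types (r : R) (z u : R[i]) (n k : nat).
Local Opaque expC.

Lemma expectationC_rlah (d : measure_display) (T : measurableType d)
    (P : probability T R) (X : {RV P >-> R}) n k r z :
  (k <= n)%N -> rlah n k r != 0 -> has_rlah_distribution n k r X ->
  expectationC P (fun w => expC (z * (X w)%:C)) =
  (rlah n k r)%:C^-1 * \sum_(k <= j < n.+1)
    (rstirling1 n j r * rstirling2 j k r)%:C * expC z ^+ j.
Proof.
move=> kn L0 hX.
pose x i : R := (i + k)%:R.
pose p i : R := (rlah n k r)^-1 * (rstirling1 n (i + k) r * rstirling2 (i + k) k r).
have x_inj : injective x.
  by move=> i j /eqP; rewrite eqr_nat eqn_add2r => /eqP.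
have Px (i : 'I_(n.+1 - k)) : P (X @^-1` [set x i]) = (p i)%:E.
  apply: hX; rewrite leq_addl /= -ltnS addnC -ltn_subRL.
  exact: ltn_ord.
have sumE (V : nmodType) (G : nat -> V) :
    \sum_(k <= j < n.+1) G j = \sum_(i < n.+1 - k) G (i + k)%N.
  by rewrite -{1}[k]add0n big_addn big_mkord.
have sp : \sum_(i < n.+1 - k) p i = 1.
  rewrite -big_distrr /= -(sumE _ (fun j => rstirling1 n j r * rstirling2 j k r)).
  by rewrite mulVf.
have cts (f : R -> R) c : continuous f ->
    measurable_fun setT (fun t => expR (Re z * t) * f (c * t)).
  move=> cf; apply: measurable_funM.
    by apply: measurableT_comp; [exact: measurable_expR|exact: mulrl_measurable].
  apply: measurableT_comp; [exact: continuous_measurable_fun|exact: mulrl_measurable].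
rewrite /expectationC.
have ReE t : Re (expC (z * t%:C)) = expR (Re z * t) * cos (Im z * t).
  by rewrite Re_expC [z * _]mulrC ReM_real ImM_real !(mulrC t).
have ImE t : Im (expC (z * t%:C)) = expR (Re z * t) * sin (Im z * t).
  by rewrite Im_expC [z * _]mulrC ReM_real ImM_real !(mulrC t).
have -> : (fun w => Re (expC (z * (X w)%:C))) =
    (fun w => expR (Re z * X w) * cos (Im z * X w)).
  by apply/funext => w; rewrite ReE.
have -> : (fun w => Im (expC (z * (X w)%:C))) =
    (fun w => expR (Re z * X w) * sin (Im z * X w)).
  by apply/funext => w; rewrite ImE.
rewrite (expectation_finite_support x_inj (cts _ (Im z) (@continuous_cos R)) Px sp).
rewrite (expectation_finite_support x_inj (cts _ (Im z) (@continuous_sin R)) Px sp).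
rewrite sumE /= big_distrr /=.
have -> : \sum_(i < n.+1 - k) (rlah n k r)%:C^-1 *
    ((rstirling1 n (i + k) r * rstirling2 (i + k) k r)%:C * expC z ^+ (i + k)) =
  \sum_(i < n.+1 - k) (p i)%:C * expC (z * (x i)%:C).
  apply: eq_bigr => i _; rewrite /p [in RHS]rmorphM /= fmorphV /= -[RHS]mulrA.
  congr (_ * (_ * _)).
  by rewrite rmorph_nat expC_natmul.
apply/eqP; rewrite eq_complex /=.
rewrite (big_morph _ (@ReD R) (erefl : Re 0 = 0)).
rewrite (big_morph _ (@ImD R) (erefl : Im 0 = 0)).
apply/andP; split; apply/eqP; apply: eq_bigr => i _.
  by rewrite ReM_real ReE.
by rewrite ImM_real ImE.
Qed.

End LahMgf.

(** * The ratio, its limit and the uniform rate *)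

Section LahLimit.
Variable R : realType.
Local Notation normc := (@Normc.normc R).
Local Notation Re := (@complex.Re R).
Local Notation Im := (@complex.Im R).
Implicit Types (r : R) (z u : R[i]) (n k : nat).
Local Opaque expC.

Lemma lah_sumE n k r u :
  k`!%:R * (\sum_(k <= j < n.+1)
    (rstirling1 n j r * rstirling2 j k r)%:C * u ^+ j) =
  n.-1`!%:R * expC (lah_point r k u * (ln n%:R)%:C) * lah_sum n k r u.
Proof.
rewrite sum_rlah /lah_sum big_distrr /=; apply: eq_bigr => i _.
by rewrite [RHS]mulrC divfK// mulf_neq0 ?expC_neq0.
Qed.

Lemma lah_sum1E n k r :
  k`!%:R * (rlah n k r)%:C =
  n.-1`!%:R * expC (lah_point r k 1 * (ln n%:R)%:C) * lah_sum n k r 1.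
Proof.
rewrite -lah_sumE /rlah rmorph_sum /=; congr (_ * _).
by apply: eq_bigr => j _; rewrite expr1n mulr1.
Qed.

(** The exponents match because s_k(u) - s_k(1) = (k + r)(u - 1): the normalising exponential is
    exactly the quotient of the two growth factors, and k! and (n - 1)! cancel. *)
Lemma lah_mgf_ratioE (d : measure_display) (T : measurableType d)
    (P : probability T R) (X : {RV P >-> R}) n k r z :
  (k <= n)%N -> lah_sum n k r 1 != 0 -> has_rlah_distribution n k r X ->
  lah_mgf_ratio X n k r z = lah_sum n k r (expC z) / lah_sum n k r 1.
Proof.
move=> kn N0 hX; set u := expC z.
have f0 m : m`!%:R != 0 :> R[i] by rewrite pnatr_eq0 -lt0n fact_gt0.
have L1 := lah_sum1E n k r; have Lu := lah_sumE n k r u.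
have L0 : rlah n k r != 0.
  apply/eqP => L0; have := mulf_neq0 (mulf_neq0 (f0 n.-1)
    (expC_neq0 (lah_point r k 1 * (ln n%:R)%:C))) N0.
  by rewrite -L1 L0 rmorph0 mulr0 eqxx.
rewrite /lah_mgf_ratio (expectationC_rlah z kn L0 hX) -/u.
have -> : (k%:R + r)%:C * (ln n%:R)%:C * (u - 1) =
    lah_point r k u * (ln n%:R)%:C - lah_point r k 1 * (ln n%:R)%:C.
  by rewrite /lah_point; ring.
rewrite expCB.
move: (expC_neq0 (lah_point r k u * (ln n%:R)%:C)).
move: (expC_neq0 (lah_point r k 1 * (ln n%:R)%:C)).
have LC0 : (rlah n k r)%:C != 0 by rewrite fmorph_eq0.
move: (expC _) (expC (lah_point r k 1 * _)) L1 Lu => a b.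
move: (rlah n k r)%:C LC0 (lah_sum n k r u) (lah_sum n k r 1) N0 => L LC0 x y y0.
move: (\sum_(_ <= _ < _) _) (f0 k) (f0 n.-1) => S.
move: k`!%:R n.-1`!%:R => f g ff gg L1 Lu b0 a0.
have -> : S = g * a * x / f by rewrite -Lu mulrC mulKf.
have -> : L = g * b * y / f by rewrite -L1 mulrC mulKf.
by field; rewrite ff gg a0 b0 y0.
Qed.

Lemma lah_point1 k r : lah_point r k 1 = (k%:R + 2 * r)%:C.
Proof. by rewrite /lah_point mulr1 -rmorphD /=; congr (_ %:C); ring. Qed.

Lemma normc_div_sub_le (a b x y : R[i]) : x != 0 -> y != 0 ->
  normc (a / x - b / y) <=
    (normc (a - b) * normc y + normc b * normc (x - y)) / (normc x * normc y).
Proof.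
move=> x0 y0.
have -> : a / x - b / y = ((a - b) * y - b * (x - y)) / (x * y).
  by field; rewrite x0 y0.
rewrite Normc.normcM Normc.normcV [normc (x * y)]Normc.normcM.
rewrite ler_wpM2r ?invr_ge0 ?mulr_ge0 ?normc_ge0//.
by rewrite -!Normc.normcM normcB_le.
Qed.

(** The dependence on [z] is reduced to two bounds on e^z, which compactness supplies later. *)
Lemma lah_mgf_ratio_rate k r (d : nat -> measure_display)
    (T : forall n, measurableType (d n)) (P : forall n, probability (T n) R)
    (X : forall n, {RV (P n) >-> R}) (B dl : R) :
  0 <= r -> 0 < k%:R + r ->
  (forall n, (0 < n)%N -> (k <= n)%N -> has_rlah_distribution n k r (X n)) ->
  0 < dl ->
  exists2 eps : R, 0 < eps & exists C : R, \forall n \near \oo,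
    forall z, dl <= Re (expC z) -> normc (expC z) <= B ->
    normc (lah_mgf_ratio (X n) n k r z - lah_mgf_limit k r z) <=
      C * n%:R `^ (- eps).
Proof.
move=> r0 kr0 hX dl0.
set e : R := Num.min dl 2^-1.
have e0 : 0 < e by rewrite lt_min dl0 invr_gt0 ltr0n.
have ed : e <= dl by rewrite ge_min lexx.
have e2 : e <= 2^-1 by rewrite ge_min lexx orbT.
have [C C0 hC] := lah_sum_cvg B r0 kr0 dl0 (ltW e0) ed e2.
have e1 : e <= 1 by apply: le_trans e2 _; rewrite invf_le1// ler1n.
have [C1 C10 hC1] := lah_sum_cvg 1 r0 kr0 ltr01 (ltW e0) e1 e2.
have n11 : normc 1 <= 1 by rewrite Normc.normc1.
have {}hC1 n (n0 : (0 < n)%N) := hC1 n 1 n0 (lexx 1) n11.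
have [g0 _ _] := hC1 1%N isT.
set G := gammaC (lah_point r k 1) in g0 hC1.
have gp : 0 < normc G^-1.
  by rewrite lt_neqAle normc_ge0 eq_sym normc_eq0 invr_eq0 g0.
have q0 : 0 < normc G^-1 / 2 / C1 by rewrite !divr_gt0.
exists e => //; exists ((C * normc G^-1 + C * C1) / (normc G^-1 / 2 * normc G^-1)).
near=> n => z zd zB.
have n0 : (0 < n)%N by near: n; exists 1%N.
have kn : (k <= n)%N by near: n; exists k.
have [_ _ h1] := hC1 n n0.
have [g0z gC hz] := hC n _ n0 zd zB.
have Esmall : expR (- e * ln n%:R) < normc G^-1 / 2 / C1.
  (* This threshold makes the error at u = 1 at most half of its limit |1/G|, which keeps the
     denominator [lah_sum n k r 1] away from 0. *)
  by near: n; exact: near_expR_Nln.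
have nE : n%:R `^ (- e) = expR (- e * ln n%:R) :> R.
  by rewrite /powR pnatr_eq0 (gtn_eqF n0).
rewrite nE; set E := expR _ in h1 hz Esmall *.
have E0 : 0 < E by exact: expR_gt0.
have N1 : normc G^-1 / 2 <= normc (lah_sum n k r 1).
  have h2 : C1 * E <= normc G^-1 / 2 by rewrite mulrC -ler_pdivlMr// ltW.
  have := normcB_le (lah_sum n k r 1) (lah_sum n k r 1 - G^-1).
  rewrite opprB addrC subrK; lra.
have N0 : lah_sum n k r 1 != 0.
  by rewrite -normc_eq0 gt_eqF//; apply: lt_le_trans N1; rewrite divr_gt0.
rewrite (lah_mgf_ratioE z kn N0 (hX n n0 kn)).
have -> : lah_mgf_limit k r z = (gammaC (lah_point r k (expC z)))^-1 / G^-1.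
  by rewrite /lah_mgf_limit invrK mulrC /G lah_point1.
apply: le_trans (normc_div_sub_le _ _ N0 _) _; first by rewrite invr_eq0.
rewrite mulrAC; apply: ler_pM.
- by rewrite addr_ge0 ?mulr_ge0 ?normc_ge0.
- by rewrite invr_ge0 mulr_ge0 ?normc_ge0.
- rewrite mulrDl; apply: lerD.
    by rewrite [leRHS]mulrAC ler_wpM2r ?normc_ge0.
  by rewrite -mulrA ler_pM ?normc_ge0.
- by rewrite lef_pV2 ?posrE ?mulr_gt0 ?divr_gt0// ?(lt_le_trans _ N1) ?divr_gt0//
     ler_wpM2r// ltW.
Unshelve. all: by end_near. Qed.

(** Balls of [R[i]^o] have radii in [R[i]], so the real [eps] is embedded before norms are
    compared. *)
Lemma continuous_Re : continuous (fun z : R[i]^o => Re z).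
Proof.
move=> z; apply/(@cvgrPdist_lt _ _ _ (nbhs (z : R[i]^o))) => eps eps0; near=> w.
have : `|(z : R[i]^o) - w| < eps%:C.
  by near: w; apply: (nbhsx_ballx z eps%:C); rewrite ltcR.
rewrite normr_normc ltcR; apply: le_lt_trans.
by rewrite -ReN -ReD normc_Re_le.
Unshelve. all: by end_near. Qed.

Lemma continuous_Im : continuous (fun z : R[i]^o => Im z).
Proof.
move=> z; apply/(@cvgrPdist_lt _ _ _ (nbhs (z : R[i]^o))) => eps eps0; near=> w.
have : `|(z : R[i]^o) - w| < eps%:C.
  by near: w; apply: (nbhsx_ballx z eps%:C); rewrite ltcR.
rewrite normr_normc ltcR; apply: le_lt_trans.
by rewrite -ImN -ImD normc_Im_le.
Unshelve. all: by end_near. Qed.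

(** Re e^z and |e^z| = e^(Re z) attain their extrema on a nonempty [K]; the minimum of the first is
    positive by the definition of [D_Lah]. *)
Lemma D_Lah_compact_bounds (K : set R[i]^o) : compact K -> K `<=` @D_Lah R ->
  exists2 dl : R, 0 < dl & exists B : R, forall z, K z ->
    dl <= Re (expC z) /\ normc (expC z) <= B.
Proof.
move=> cK KD.
have [->|/set0P K0] := eqVneq K set0; first by exists 1 => //; exists 0.
have cexp : continuous (fun z : R[i]^o => expR (Re z)).
  by move=> z; apply: continuous_comp; [exact: continuous_Re|exact: continuous_expR].
have cRe : continuous (fun z : R[i]^o => expR (Re z) * cos (Im z)).
  have ccos : continuous (fun z : R[i]^o => cos (Im z)).
    by move=> z; apply: continuous_comp; [exact: continuous_Im|exact: continuous_cos].
  by move=> z; exact: (cvgM (cexp z) (ccos z)).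
have [a aK ha] := compact_EVT_min K0 cK (continuous_subspaceT cRe).
have [b bK hb] := compact_EVT_max K0 cK (continuous_subspaceT cexp).
exists (expR (Re a) * cos (Im a)).
  by rewrite mulr_gt0 ?expR_gt0//; apply: KD; move: aK; rewrite inE.
exists (expR (Re b)) => z Kz; rewrite Re_expC normc_expC.
by split; [apply: ha|apply: hb]; rewrite inE.
Qed.

Lemma uniform_cvg_rate (K : set R[i]^o) (f : nat -> R[i]^o -> R[i]^o)
    (g : R[i]^o -> R[i]^o) (C eps : R) : 0 < eps ->
  (\forall n \near \oo, forall z, K z ->
    normc (f n z - g z) <= C * n%:R `^ (- eps)) ->
  {uniform K, f @ \oo --> g}.
Proof.
move=> eps0 fg A /uniform_nbhs [E [entE EA]].
move: entE; rewrite -entourage_ballE => -[/= e e0 eE].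
(* A positive element of [R[i]] has imaginary part 0, so the radius of the entourage is a real
   number. *)
have Re0 : 0 < Re e by move: e0; rewrite ltcE => /andP[].
have eRe : e = (Re e)%:C.
  by move: e0; rewrite ltcE => /andP[/eqP /= Ie _]; rewrite [LHS]complexE Ie mulr0 addr0.
have C1 : 0 < `|C| + 1 by rewrite ltr_wpDl.
near=> n.
have h : forall z, K z -> normc (f n z - g z) <= C * n%:R `^ (- eps) by near: n.
have n0 : (0 < n)%N by near: n; exists 1%N.
have hE : expR (- eps * ln n%:R) < Re e / (`|C| + 1).
  by near: n; apply: near_expR_Nln => //; rewrite divr_gt0.
apply: EA => z Kz; apply: eE => /=.
rewrite /ball /= distrC normr_normc eRe ltcR; apply: le_lt_trans (h z Kz) _.
rewrite /powR pnatr_eq0 (gtn_eqF n0).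
apply: (@le_lt_trans _ _ (`|C| * expR (- eps * ln n%:R))).
  by rewrite ler_wpM2r ?expR_ge0// ler_norm.
move: hE; rewrite ltr_pdivlMr// mulrC; apply: le_lt_trans.
by rewrite ler_wpM2r ?expR_ge0// lerDl.
Unshelve. all: by end_near. Qed.

End LahLimit.

Theorem theorem3p11 (R : realType) (k : nat) (r : R)
    (d : nat -> measure_display) (T : forall n : nat, measurableType (d n))
    (P : forall n : nat, probability (T n) R)
    (X : forall n : nat, {RV (P n) >-> R})
    (r_ge0 : 0 <= r) (kr_gt0 : 0 < Num.max k%:R r)
    (lahX : forall n : nat, (0 < n)%N -> (k <= n)%N ->
       has_rlah_distribution n k r (X n)) :
  [/\ (forall x : R, D_Lah x%:C),
      (forall z : R[i], D_Lah z ->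
         lah_mgf_ratio (X n) n k r z @[n --> \oo] -->
           (lah_mgf_limit k r z : R[i]^o)) &
      (forall K : set R[i]^o, compact K -> K `<=` @D_Lah R ->
         {uniform K, (fun n (z : R[i]^o) => lah_mgf_ratio (X n) n k r z : R[i]^o) @ \oo -->
            (lah_mgf_limit k r : R[i]^o -> R[i]^o)} /\
         (exists2 eps : R, 0 < eps &
            exists C : R, \forall n \near \oo, forall z : R[i], K z ->
              `|lah_mgf_ratio (X n) n k r z - lah_mgf_limit k r z|
                <= (C * n%:R `^ (- eps))%:C))].
Proof.
have kr0 : 0 < k%:R + r.
  by move: kr_gt0; rewrite lt_max => /orP[h|h]; [rewrite ltr_wpDr|rewrite ltr_wpDl].
have rate (K : set R[i]^o) : compact K -> K `<=` @D_Lah R ->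
    exists2 eps : R, 0 < eps & exists C : R, \forall n \near \oo, forall z, K z ->
      Normc.normc (lah_mgf_ratio (X n) n k r z - lah_mgf_limit k r z) <=
        C * n%:R `^ (- eps).
  move=> cK KD; have [dl dl0 [B hB]] := D_Lah_compact_bounds cK KD.
  have [eps eps0 [C hC]] := lah_mgf_ratio_rate B r_ge0 kr0 lahX dl0.
  exists eps => //; exists C; apply: filterS hC => n hn z Kz.
  by have [h1 h2] := hB z Kz; exact: hn.
have unif (K : set R[i]^o) : compact K -> K `<=` @D_Lah R ->
    {uniform K, (fun n (z : R[i]^o) => lah_mgf_ratio (X n) n k r z : R[i]^o) @ \oo -->
       (lah_mgf_limit k r : R[i]^o -> R[i]^o)}.
  move=> cK KD; have [eps eps0 [C hC]] := rate K cK KD.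
  exact: uniform_cvg_rate eps0 hC.
split=> [x|z zD|K cK KD].
- by rewrite /D_Lah /= cos0.
(* Pointwise convergence is uniform convergence on a compact singleton. *)
- have zK : [set z : R[i]^o] `<=` @D_Lah R by move=> _ ->.
  have := unif _ (@compact_set1 R[i]^o z) zK.
  by rewrite uniform_set1.
- split; first exact: unif.
  have [eps eps0 [C hC]] := rate K cK KD.
  exists eps => //; exists C; apply: filterS hC => n hn z Kz.
  by rewrite normr_normc lecR hn.
Qed.
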